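(* Let $a,b,c>0$ with $a>b$, let $M_0$ be the ellipsoid $\frac{x^2}{a}+\frac{y^2}{b}+\frac{z^2}{c}=1$ in $\mathbb{R}^3$ with the metric induced from the Minkowski metric $dx^2+dy^2-dz^2$, and let $T$ be the map of the equator $\{z=0\}\cap M_0$ to itself defined as follows: given a point $P$ of the equator, follow the right null geodesic through $P$ (with $z$ increasing) until it reaches the Northern tropic at a point $Q$, then follow the left null geodesic through $Q$ until it intersects the equator at a point $P_1$, and put $T(P)=P_1$. Suppose that some point $P$ of the equator is $k$-periodic, that is, $T^k(P)=P$ for some positive integer $k$. Then every point of the equator is also $k$-periodic, i.e. $T^k(P')=P'$ for every point $P'$ of the equator.
   Context: The induced metric on $M_0$ degenerates exactly along the two curves $z=\pm c\sqrt{\frac{x^2}{a^2}+\frac{y^2}{b^2}}$ on $M_0$, called the tropics (the Northern tropic is the one with $z>0$). The open equatorial belt is the part of $M_0$ between the tropics, i.e. where $\frac{x^2}{a^2}+\frac{y^2}{b^2}-\frac{z^2}{c^2}>0$; there the metric is Lorentzian, so at each point there are two null (light-like) directions, which merge into one on the tropics. A null geodesic in the belt is (up to parameterization) an integral curve of one of the two null line fields; it traverses the belt from one tropic to the other. The two null line fields are globally distinguished on the belt: the right one is the continuous null line field which at the equator point $(\sqrt a\cos t,\sqrt b\sin t,0)$ is spanned by $(-\sqrt a\sin t,\sqrt b\cos t,f(t))$, and the left one is the continuous null line field which at that point is spanned by $(-\sqrt a\sin t,\sqrt b\cos t,-f(t))$, where $f(t)=\sqrt{a\sin^2t+b\cos^2t}$.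 Right (respectively left) null geodesics are the integral curves of the right (respectively left) null line field; each extends to its endpoints on the tropics, and through each point of the Northern tropic there passes one right and one left null geodesic ending there. *)

(* Defs.v *)
From Stdlib Require Import Reals ClassicalEpsilon.
From Coquelicot Require Import Coquelicot.
Open Scope R_scope.

Definition R3 : Type := (R * R * R)%type.

Definition pt (x y z : R) : R3 := (x, y, z).
Definition xc (p : R3) : R := fst (fst p).
Definition yc (p : R3) : R := snd (fst p).
Definition zc (p : R3) : R := snd p.

Definition minkowski (v w : R3) : R :=
  xc v * xc w + yc v * yc w - zc v * zc w.

Definition ellipsoid (a b c : R) (p : R3) : Prop :=
  xc p ^ 2 / a + yc p ^ 2 / b + zc p ^ 2 / c = 1.

(* Kernel of half the differential of the defining function of the ellipsoid. *)
Definition tangent (a b c : R) (p w : R3) : Prop :=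
  xc p * xc w / a + yc p * yc w / b + zc p * zc w / c = 0.

Definition equator (a b c : R) (p : R3) : Prop :=
  ellipsoid a b c p /\ zc p = 0.

Definition north_tropic (a b c : R) (p : R3) : Prop :=
  ellipsoid a b c p /\ zc p = c * sqrt (xc p ^ 2 / a ^ 2 + yc p ^ 2 / b ^ 2).

Definition south_tropic (a b c : R) (p : R3) : Prop :=
  ellipsoid a b c p /\ zc p = - (c * sqrt (xc p ^ 2 / a ^ 2 + yc p ^ 2 / b ^ 2)).

Definition tropic (a b c : R) (p : R3) : Prop :=
  north_tropic a b c p \/ south_tropic a b c p.

Definition belt (a b c : R) (p : R3) : Prop :=
  ellipsoid a b c p /\ xc p ^ 2 / a ^ 2 + yc p ^ 2 / b ^ 2 - zc p ^ 2 / c ^ 2 > 0.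

(* A line field is a family of subsets [l p] of R^3, used only for p in the
   belt, where [l p] must be a line through the origin. *)
Definition line_field : Type := R3 -> R3 -> Prop.

Definition in_span (v w : R3) : Prop :=
  exists t : R, w = pt (t * xc v) (t * yc v) (t * zc v).

Definition spans_line (l : R3 -> Prop) (v : R3) : Prop :=
  v <> pt 0 0 0 /\ (forall w : R3, l w <-> in_span v w).

(* Continuity of a line field: around each point of the belt it is spanned by a
   continuous nonvanishing vector field. *)
Definition continuous_line_field (a b c : R) (l : line_field) : Prop :=
  forall p : R3, belt a b c p ->
    exists (U : R3 -> Prop) (V : R3 -> R3),
      open U /\ U p /\
      continuous_on (fun q => U q /\ belt a b c q) V /\
      (forall q : R3, U q -> belt a b c q -> spans_line (l q) (V q)).

Definition null_line_field (a b c : R) (l : line_field) : Prop :=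
  continuous_line_field a b c l /\
  (forall p w : R3, belt a b c p -> l p w ->
     tangent a b c p w /\ minkowski w w = 0).

Definition equator_pt (a b t : R) : R3 := pt (sqrt a * cos t) (sqrt b * sin t) 0.

Definition equator_f (a b t : R) : R := sqrt (a * sin t ^ 2 + b * cos t ^ 2).

Definition right_null_field (a b c : R) (l : line_field) : Prop :=
  null_line_field a b c l /\
  (forall t : R, spans_line (l (equator_pt a b t))
     (pt (- sqrt a * sin t) (sqrt b * cos t) (equator_f a b t))).

Definition left_null_field (a b c : R) (l : line_field) : Prop :=
  null_line_field a b c l /\
  (forall t : R, spans_line (l (equator_pt a b t))
     (pt (- sqrt a * sin t) (sqrt b * cos t) (- equator_f a b t))).

(* Full integral curves of [l], reparameterized over (0, 1) and extended by
   continuity to their endpoints on the tropics; no velocity condition is imposed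
   at the endpoints, where the two null directions merge. *)
Definition null_geodesic (a b c : R) (l : line_field) (g : R -> R3) : Prop :=
  continuous_on (fun s => 0 <= s <= 1) g /\
  tropic a b c (g 0) /\ tropic a b c (g 1) /\
  (forall s : R, 0 < s < 1 ->
     belt a b c (g s) /\
     exists v : R3, is_derive g s v /\ v <> pt 0 0 0 /\ l (g s) v).

Definition right_null_geodesic (a b c : R) (g : R -> R3) : Prop :=
  exists l : line_field, right_null_field a b c l /\ null_geodesic a b c l g.

Definition left_null_geodesic (a b c : R) (g : R -> R3) : Prop :=
  exists l : line_field, left_null_field a b c l /\ null_geodesic a b c l g.

Definition right_up (a b c : R) (P Q : R3) : Prop :=
  exists (g : R -> R3) (s : R),
    right_null_geodesic a b c g /\
    (forall s1 s2 : R, 0 <= s1 -> s1 < s2 -> s2 <= 1 -> zc (g s1) < zc (g s2)) /\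
    0 < s < 1 /\ g s = P /\ g 1 = Q /\ north_tropic a b c Q.

Definition left_down (a b c : R) (Q P1 : R3) : Prop :=
  exists (g : R -> R3) (t : R),
    left_null_geodesic a b c g /\
    g 0 = Q /\ 0 < t < 1 /\ g t = P1 /\ equator a b c P1 /\
    (forall u : R, 0 <= u < t -> ~ equator a b c (g u)).

Definition T_graph (a b c : R) (P P1 : R3) : Prop :=
  exists Q : R3, right_up a b c P Q /\ left_down a b c Q P1.

(* The value off the equator is irrelevant. On the equator [T_graph] is
   single-valued and everywhere defined, so [T] is the map with that graph. *)
Definition T (a b c : R) (P : R3) : R3 :=
  epsilon (inhabits P) (T_graph a b c P).

(* Main.v *)
(* The belt is parametrized by [-1 < s < 1] and an angle [phi] through the confocal coordinates
   [mu = c (1 - s^2)] and [- nu = - (a sin^2 phi + b cos^2 phi)] of a point of the ellipsoid.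
   In these coordinates the induced metric is
   [(mu + nu) (B(phi)^2 dphi^2 - A(s)^2 ds^2)], so with [alpha = int A ds] and
   [beta = int B dphi] the right null geodesics are the curves [beta - alpha = const] and the
   left ones the curves [beta + alpha = const]. The tropics are [s = 1] and [s = -1], the
   equator is [s = 0], hence [T] is the translation [beta |-> beta + 2 alpha(1)] modulo the
   period [beta(2 PI)]. If its k-th iterate fixes one point then [2 k alpha(1)] is a multiple
   of the period, and the k-th iterate is the identity.

   A null geodesic is only assumed differentiable, so its angle is lifted locally: there
   [beta -+ alpha] has derivative zero, and connectedness of [0, 1] glues the local
   statements. That a continuous null line field keeps the sign it has on the equator
   follows in the same way along the curves [phi = const]. *)

Require Import Defs.
From Stdlib Require Import Reals ZArith Lra Lia Psatz ClassicalEpsilon.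
From Coquelicot Require Import Coquelicot.
Open Scope R_scope.

(** * Continuity and differentiability of real-valued expressions *)

Section RealValued.
Context {U : UniformSpace} (f g : U -> R) (x : U).

Lemma cont_plus : continuous f x -> continuous g x -> continuous (fun t => f t + g t) x.
Proof. exact (continuous_plus (V := R_NormedModule) f g x). Qed.

Lemma cont_minus : continuous f x -> continuous g x -> continuous (fun t => f t - g t) x.
Proof. exact (continuous_minus (V := R_NormedModule) f g x). Qed.

Lemma cont_opp : continuous f x -> continuous (fun t => - f t) x.
Proof. exact (continuous_opp (V := R_NormedModule) f x). Qed.

Lemma cont_mult : continuous f x -> continuous g x -> continuous (fun t => f t * g t) x.
Proof. exact (continuous_mult (K := R_AbsRing) f g x). Qed.

Lemma cont_div : continuous f x -> continuous g x -> g x <> 0 ->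
  continuous (fun t => f t / g t) x.
Proof.
  intros Hf Hg H. apply (continuous_mult (K := R_AbsRing) f (fun t => / g t) x Hf).
  apply (continuous_comp g Rinv); [easy | now apply continuous_Rinv].
Qed.

Lemma cont_sqrt : continuous f x -> continuous (fun t => sqrt (f t)) x.
Proof. intros Hf; apply (continuous_comp f sqrt); [easy | apply continuous_sqrt]. Qed.

Lemma cont_sin : continuous f x -> continuous (fun t => sin (f t)) x.
Proof. intros Hf; apply (continuous_comp f sin); [easy | apply continuous_sin]. Qed.

Lemma cont_cos : continuous f x -> continuous (fun t => cos (f t)) x.
Proof. intros Hf; apply (continuous_comp f cos); [easy | apply continuous_cos]. Qed.

Lemma cont_pow n : continuous f x -> continuous (fun t => f t ^ n) x.
Proof.
  intros Hf; induction n as [|n IH]; simpl; [apply continuous_const|].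
  exact (continuous_mult (K := R_AbsRing) f (fun t => f t ^ n) x Hf IH).
Qed.

Lemma cont_pos_near : continuous f x -> 0 < f x -> locally x (fun t => 0 < f t).
Proof.
  intros Hf H. apply (Hf (fun y => 0 < y)). exact (open_gt 0 (f x) H).
Qed.

End RealValued.

(** Recursion on the shape of the expression; nonvanishing of denominators and unknown atomic
    continuities remain as goals. A product by a constant in the eta-reduced form [Rmult k] is
    expanded so that the product rule sees it. *)
Ltac cont :=
  lazymatch goal with
  | |- continuous (fun _ => _ + _) _ => apply cont_plus; cont
  | |- continuous (fun _ => _ - _) _ => apply cont_minus; cont
  | |- continuous (fun _ => - _) _ => apply cont_opp; cont
  | |- continuous (fun _ => _ * _) _ => apply cont_mult; cont
  | |- continuous (fun _ => _ / _) _ => apply cont_div; cont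
  | |- continuous (fun _ => _ ^ _) _ => apply cont_pow; cont
  | |- continuous (fun _ => sqrt _) _ => apply cont_sqrt; cont
  | |- continuous (fun _ => sin _) _ => apply cont_sin; cont
  | |- continuous (fun _ => cos _) _ => apply cont_cos; cont
  | |- continuous (fun x => x) _ => apply continuous_id
  | |- continuous (Rmult ?k) ?x => change (continuous (fun t => k * t) x); cont
  | |- continuous (fun _ => ?k) _ => apply continuous_const
  | |- continuous _ _ => try assumption
  | |- _ => idtac
  end.

Lemma ex_derive_sqrt (f : R -> R) (t : R) :
  ex_derive f t -> 0 < f t -> ex_derive (fun u => sqrt (f u)) t.
Proof. intros Hf H. apply (ex_derive_comp sqrt f); [auto_derive; easy | easy]. Qed.

Ltac exd :=
  lazymatch goal with
  | |- ex_derive (fun _ => _ + _) _ => apply (ex_derive_plus (V := R_NormedModule)); exd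
  | |- ex_derive (fun _ => _ - _) _ => apply (ex_derive_minus (V := R_NormedModule)); exd
  | |- ex_derive (fun _ => _ * _) _ => apply ex_derive_mult; exd
  | |- ex_derive (fun _ => _ / _) _ => apply ex_derive_div; exd
  | |- ex_derive (fun _ => _ ^ _) _ => apply ex_derive_pow; exd
  | |- ex_derive (fun _ => sqrt _) _ => apply ex_derive_sqrt; exd
  | |- ex_derive (fun _ => ?k) _ => apply ex_derive_const
  | |- ex_derive _ _ => try assumption
  | |- _ => idtac
  end.

(** * Continuity and derivatives of curves in [R3] *)

Lemma continuous_pair {U V W : UniformSpace} (f : U -> V) (g : U -> W) (x : U) :
  continuous f x -> continuous g x -> continuous (fun t => (f t, g t)) x.
Proof.
  intros Hf Hg. apply (continuous_comp_2 f g (fun p q => (p, q))); [easy..|].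
  apply (continuous_ext (fun p => p)); [now intros [p q] | apply continuous_id].
Qed.

Lemma continuous_pt {U : UniformSpace} (f g h : U -> R) (x : U) :
  continuous f x -> continuous g x -> continuous h x ->
  continuous (fun t => pt (f t) (g t) (h t)) x.
Proof. intros Hf Hg Hh. apply continuous_pair; [now apply continuous_pair | easy]. Qed.

Lemma continuous_xc (p : R3) : continuous xc p.
Proof.
  destruct p as [[x y] z]. apply (continuous_comp fst fst); apply continuous_fst.
Qed.

Lemma continuous_yc (p : R3) : continuous yc p.
Proof.
  destruct p as [[x y] z].
  apply (continuous_comp fst snd); [apply continuous_fst | apply continuous_snd].
Qed.

Lemma continuous_zc (p : R3) : continuous zc p.
Proof. destruct p as [[x y] z]. apply continuous_snd. Qed.

Lemma is_derive_fst {U V : NormedModule R_AbsRing} (g : R -> U * V) (t : R) (v : U * V) :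
  is_derive (V := prod_NormedModule _ U V) g t v -> is_derive (fun s => fst (g s)) t (fst v).
Proof.
  intros H. unfold is_derive in *.
  exact (filterdiff_comp' (K := R_AbsRing) g fst t _ fst H
    (filterdiff_linear (K := R_AbsRing) (F := locally (g t)) fst is_linear_fst)).
Qed.

Lemma is_derive_snd {U V : NormedModule R_AbsRing} (g : R -> U * V) (t : R) (v : U * V) :
  is_derive (V := prod_NormedModule _ U V) g t v -> is_derive (fun s => snd (g s)) t (snd v).
Proof.
  intros H. unfold is_derive in *.
  exact (filterdiff_comp' (K := R_AbsRing) g snd t _ snd H
    (filterdiff_linear (K := R_AbsRing) (F := locally (g t)) snd is_linear_snd)).
Qed.

Lemma is_derive_pair {U V : NormedModule R_AbsRing} (f : R -> U) (g : R -> V) (t : R) u v :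
  is_derive f t u -> is_derive g t v ->
  is_derive (V := prod_NormedModule _ U V) (fun s => (f s, g s)) t (u, v).
Proof.
  intros Hf Hg. unfold is_derive in *.
  apply (filterdiff_comp'_2 (W := prod_NormedModule _ U V) f g (fun p q => (p, q)) t
    _ _ (fun p q => (p, q)) Hf Hg).
  apply (filterdiff_ext (fun t => t)); [now intros [p q]|].
  apply (filterdiff_ext_lin _ (fun t => t)); [apply filterdiff_id | now intros [p q]].
Qed.

Lemma is_derive_R3 (g : R -> R3) (t : R) (v : R3) :
  is_derive g t v <->
  is_derive (fun s => xc (g s)) t (xc v) /\ is_derive (fun s => yc (g s)) t (yc v) /\
  is_derive (fun s => zc (g s)) t (zc v).
Proof.
  split.
  - intros H. pose proof (is_derive_fst _ _ _ H) as H1.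
    split; [exact (is_derive_fst _ _ _ H1)|].
    split; [exact (is_derive_snd _ _ _ H1) | exact (is_derive_snd _ _ _ H)].
  - intros (H1 & H2 & H3).
    apply (is_derive_ext (fun s => ((xc (g s), yc (g s)), zc (g s)))).
    { intros s; now destruct (g s) as [[? ?] ?]. }
    destruct v as [[v1 v2] v3]. apply is_derive_pair; [now apply is_derive_pair | easy].
Qed.

Lemma continuous_of_is_derive_R3 (g : R -> R3) (t : R) (v : R3) :
  is_derive g t v -> continuous g t.
Proof.
  intros H. apply (ex_derive_continuous (V := prod_NormedModule _
    (prod_NormedModule _ R_NormedModule R_NormedModule) R_NormedModule)). now exists v.
Qed.

(** * Real analysis on a segment *)

(** The retraction of the line onto [[u, v]]. Precomposition with it turns continuity on the segment
    into continuity on all of [R], which [IVT_gen] demands. *)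
Definition clamp (u v t : R) : R := Rmax u (Rmin v t).

Lemma clamp_in u v t : u <= v -> u <= clamp u v t <= v.
Proof. intros; unfold clamp, Rmax, Rmin; repeat destruct Rle_dec; lra. Qed.

Lemma clamp_id u v t : u <= t <= v -> clamp u v t = t.
Proof. intros; unfold clamp, Rmax, Rmin; repeat destruct Rle_dec; lra. Qed.

Lemma clamp_lip u v s t : Rabs (clamp u v s - clamp u v t) <= Rabs (s - t).
Proof.
  unfold clamp, Rmax, Rmin, Rabs; repeat (destruct Rle_dec || destruct Rcase_abs); lra.
Qed.

Lemma continuous_on_of_continuous {U V : UniformSpace} (D : U -> Prop) (f : U -> V) :
  (forall x, D x -> continuous f x) -> continuous_on D f.
Proof.
  intros H x Hx Q HQ. unfold filtermap, within.
  apply (filter_imp (fun y => Q (f y))); [easy | exact (H x Hx Q HQ)].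
Qed.

Lemma continuous_clamp {U : UniformSpace} (f : R -> U) u v : u <= v ->
  continuous_on (fun s => u <= s <= v) f -> forall t, continuous (fun s => f (clamp u v s)) t.
Proof.
  intros Huv Hf t P HP.
  destruct (Hf (clamp u v t) (clamp_in u v t Huv) P HP) as [d Hd].
  exists d; intros s Hs. apply Hd; [|now apply clamp_in].
  exact (Rle_lt_trans _ _ _ (clamp_lip u v s t) Hs).
Qed.

(** Connectedness of the segment. The function equal to 1 where the clamped property holds and to -1
    elsewhere is continuous; if the endpoints disagreed, the intermediate value theorem would give
    it a zero. *)
Lemma locally_constant_prop (P : R -> Prop) (u v : R) : u <= v ->
  (forall s, u <= s <= v -> exists d : posreal, forall t, u <= t <= v ->
     Rabs (t - s) < d -> (P s <-> P t)) ->
  (P u <-> P v).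
Proof.
  intros Huv HP.
  set (f := fun t => if excluded_middle_informative (P (clamp u v t)) then 1 else -1).
  assert (Hf : continuity f).
  { intros x. apply continuity_pt_filterlim. intros Q HQ.
    destruct (HP (clamp u v x) (clamp_in u v x Huv)) as [d Hd].
    exists d. intros t Ht.
    specialize (Hd (clamp u v t) (clamp_in u v t Huv) (Rle_lt_trans _ _ _ (clamp_lip u v t x) Ht)).
    replace (f t) with (f x); [now apply locally_singleton|].
    unfold f; destruct excluded_middle_informative, excluded_middle_informative; tauto. }
  assert (H0 : forall t, f t <> 0).
  { intros t; unfold f; destruct excluded_middle_informative; lra. }
  assert (Hu : f u = if excluded_middle_informative (P u) then 1 else -1).
  { unfold f; rewrite clamp_id; [easy|lra]. }
  assert (Hv : f v = if excluded_middle_informative (P v) then 1 else -1).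
  { unfold f; rewrite clamp_id; [easy|lra]. }
  destruct (excluded_middle_informative (P u)), (excluded_middle_informative (P v)); try tauto;
  (destruct (IVT_gen f u v 0 Hf) as [x [_ Hx]]; [|now destruct (H0 x)]);
  rewrite Hu, Hv; unfold Rmin, Rmax; destruct Rle_dec; lra.
Qed.

Lemma constant_of_derive_0 (f : R -> R) (u v : R) : u <= v ->
  (forall t, u <= t <= v -> continuous f t) ->
  (forall t, u < t < v -> is_derive f t 0) -> f u = f v.
Proof.
  intros Huv Hc Hd.
  destruct (MVT_gen f u v (fun _ => 0)) as [x [_ Hx]].
  - intros x; rewrite Rmin_left, Rmax_right by easy; apply Hd.
  - intros x; rewrite Rmin_left, Rmax_right by easy.
    intros; now apply continuity_pt_filterlim, Hc.
  - lra.
Qed.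

Lemma increasing_of_derive_pos (f df : R -> R) (u v : R) : u < v ->
  (forall t, u <= t <= v -> continuous f t) ->
  (forall t, u < t < v -> is_derive f t (df t) /\ 0 < df t) -> f u < f v.
Proof.
  intros Huv Hc Hd.
  (* The point returned by [MVT_gen] may be an endpoint, where nothing is known of [df]; the value 1
     outside the open interval keeps the slope positive there too. *)
  destruct (MVT_gen f u v (fun t => if excluded_middle_informative (u < t < v) then df t else 1))
    as [w [_ E]].
  - intros t; rewrite Rmin_left, Rmax_right by lra; intros Ht.
    destruct excluded_middle_informative; [now apply Hd | easy].
  - intros t; rewrite Rmin_left, Rmax_right by lra.
    intros; now apply continuity_pt_filterlim, Hc.
  - destruct excluded_middle_informative as [Hw|Hw]; [|lra].
    pose proof (proj2 (Hd w Hw)); nra.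
Qed.

(** The mean value theorem gives [m * (y - x) <= f y - f x] for [x <= y], hence bijectivity and an
    inverse that is Lipschitz with constant [1 / m]. Its continuity feeds the differentiation rule
    for reciprocal functions. *)
Lemma inverse_of_expanding (f df : R -> R) (m : R) : 0 < m ->
  (forall x, is_derive f x (df x)) -> (forall x, m <= df x) ->
  exists g : R -> R, (forall y, f (g y) = y) /\ (forall x, g (f x) = x) /\
    (forall y, is_derive g y (/ df (g y))).
Proof.
  intros Hm Hd Hb.
  assert (Hc : continuity f).
  { intros x. apply derivable_continuous_pt. exists (df x). now apply is_derive_Reals. }
  assert (Hi : forall x y, x <= y -> m * (y - x) <= f y - f x).
  { intros x y Hxy. destruct (MVT_gen f x y df) as [w [_ E]].
    - intros; apply Hd.
    - intros; apply Hc.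
    - rewrite E. pose proof (Hb w). nra. }
  assert (Hs : forall y, { x | f x = y }).
  (* On each side of 0 the function moves by at least [m * r = Rabs (y - f 0)], so its values at
     [- r] and [r] enclose [y]. *)
  { intros y. set (r := Rabs (y - f 0) / m).
    assert (Hr : m * r = Rabs (y - f 0)) by (unfold r; field; lra).
    assert (0 <= r) by (apply Rdiv_le_0_compat; [apply Rabs_pos | easy]).
    pose proof (Hi (- r) 0 ltac:(lra)); pose proof (Hi 0 r ltac:(lra)).
    pose proof (Rle_abs (y - f 0)); pose proof (Rabs_maj2 (y - f 0)).
    destruct (IVT_gen f (- r) r y Hc) as [x [_ Hx]]; [|now exists x].
    rewrite Rmin_left, Rmax_right; nra. }
  set (g := fun y => proj1_sig (Hs y)).
  assert (Hfg : forall y, f (g y) = y) by (intros y; exact (proj2_sig (Hs y))).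
  assert (Hgf : forall x, g (f x) = x).
  { intros x. destruct (Rtotal_order (g (f x)) x) as [K|[K|K]]; [|easy|];
    pose proof (Hi _ _ (Rlt_le _ _ K)) as Hk; rewrite Hfg in Hk; nra. }
  assert (Hg : forall y z, y <= z -> 0 <= g z - g y <= (z - y) / m).
  { intros y z Hyz. destruct (Rle_dec (g y) (g z)) as [K|K].
    - split; [lra|]. pose proof (Hi _ _ K) as Hk. rewrite !Hfg in Hk.
      apply Rle_div_r; lra.
    - pose proof (Hi (g z) (g y) ltac:(lra)) as Hk. rewrite !Hfg in Hk. nra. }
  assert (Hgc : forall y, continuity_pt g y).
  { intros y eps Heps. exists (m * eps). split; [nra|]. intros z [_ Hz].
    simpl in *; unfold Rdist in *.
    assert (K : Rabs (g z - g y) <= Rabs (z - y) / m).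
    { destruct (Rle_dec y z).
      - pose proof (Hg y z ltac:(easy)). rewrite !Rabs_right; lra.
      - pose proof (Hg z y ltac:(lra)). rewrite Rabs_minus_sym, (Rabs_minus_sym z y).
        rewrite !Rabs_right; lra. }
    apply (Rle_lt_trans _ _ _ K). apply Rlt_div_l; lra. }
  exists g; split; [easy|split; [easy|]]. intros y.
  apply is_derive_Reals.
  assert (Prf : forall x, g (y - 1) <= x <= g (y + 1) -> derivable_pt f x).
  { intros x _. exists (df x). now apply is_derive_Reals. }
  assert (Hy : g (y - 1) <= g y <= g (y + 1)).
  { pose proof (Hg (y - 1) y ltac:(lra)); pose proof (Hg y (y + 1) ltac:(lra)); lra. }
  assert (E : derive_pt f (g y) (Prf (g y) Hy) = df (g y)).
  { apply derive_pt_eq_0. now apply is_derive_Reals. }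
  pose proof (Hb (g y)).
  replace (/ df (g y)) with (1 / derive_pt f (g y) (Prf (g y) Hy)) by (rewrite E; field; lra).
  apply (Ranalysis5.derivable_pt_lim_recip_interv f g (y - 1) (y + 1)); try lra; try easy.
  intros x _. apply Hfg.
Qed.

(** * Angles of points of the unit circle *)

(** [acos] only reaches the upper half circle, so a negative [S] takes the opposite angle. *)
Lemma polar C S : C ^ 2 + S ^ 2 = 1 -> exists t, cos t = C /\ sin t = S.
Proof.
  intros H. assert (HC : -1 <= C <= 1) by nra.
  assert (E : sqrt (1 - C²) = Rabs S).
  { rewrite <- sqrt_Rsqr_abs. f_equal. unfold Rsqr; lra. }
  destruct (Rle_dec 0 S).
  - exists (acos C). rewrite cos_acos, sin_acos, E by easy. split; [easy|]. apply Rabs_right; lra.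
  - exists (- acos C). rewrite cos_neg, sin_neg, cos_acos, sin_acos, E by easy.
    split; [easy|]. rewrite Rabs_left; lra.
Qed.

(** The hypotheses give [cos (t' - t) = 1], and the half-angle formula turns this into a zero of the
    sine, which the library locates. *)
Lemma angle_unique t t' : cos t = cos t' -> sin t = sin t' ->
  exists k : Z, t' = t + IZR k * (2 * PI).
Proof.
  intros Hc Hs.
  assert (H : cos (t' - t) = 1).
  { rewrite cos_minus, Hc, Hs. pose proof (sin2_cos2 t'); unfold Rsqr in *; lra. }
  assert (H2 : sin ((t' - t) / 2) = 0).
  { replace (t' - t) with (2 * ((t' - t) / 2)) in H by field.
    rewrite cos_2a_sin in H. nra. }
  destruct (sin_eq_0_0 _ H2) as [k Hk]. exists k. lra.
Qed.

(* The branch of the angle around [t0], valid on the half circle centred at [t0]. *)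
Lemma local_angle t0 C S : C ^ 2 + S ^ 2 = 1 -> 0 < C * cos t0 + S * sin t0 ->
  let t := t0 + atan ((S * cos t0 - C * sin t0) / (C * cos t0 + S * sin t0)) in
  cos t = C /\ sin t = S.
Proof.
  intros H HD. pose proof (sin2_cos2 t0) as H0; unfold Rsqr in H0.
  set (N := S * cos t0 - C * sin t0) in *. set (D := C * cos t0 + S * sin t0) in *.
  (* [N] and [D] are the sine and cosine of the angle of [(C, S)] measured from [t0]; since [D > 0],
     that angle is [atan (N / D)] up to full turns. *)
  assert (E1 : N ^ 2 + D ^ 2 = 1).
  { transitivity ((C ^ 2 + S ^ 2) * (sin t0 * sin t0 + cos t0 * cos t0)); [unfold N, D; ring|].
    rewrite H, H0; ring. }
  assert (E2 : sqrt (1 + (N / D)²) = / D).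
  { replace (1 + (N / D)²) with ((/ D) ^ 2).
    - apply sqrt_pow2. now apply Rlt_le, Rinv_0_lt_compat.
    - transitivity ((N ^ 2 + D ^ 2) / D ^ 2); [rewrite E1 | unfold Rsqr]; field; lra. }
  intros t; unfold t. rewrite cos_plus, sin_plus, cos_atan, sin_atan, E2.
  split.
  - transitivity (cos t0 * D - sin t0 * N); [field; lra|].
    transitivity (C * (sin t0 * sin t0 + cos t0 * cos t0)); [unfold N, D; ring|rewrite H0; ring].
  - transitivity (sin t0 * D + cos t0 * N); [field; lra|].
    transitivity (S * (sin t0 * sin t0 + cos t0 * cos t0)); [unfold N, D; ring|rewrite H0; ring].
Qed.

(** * Separating coordinates on the belt *)

Section Belt.
Context (a b c : R) (ha : 0 < a) (hb : 0 < b) (hc : 0 < c) (hab : b < a).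

Definition mu (s : R) : R := c * (1 - s ^ 2).
Definition nu (C S : R) : R := a * S ^ 2 + b * C ^ 2.
(** Confocal coordinates satisfy [x^2 = a (a + mu) (a - nu) / ((a - b) (a + c))], and similarly for
    [y] and [z]. As [a - nu = (a - b) C^2], [nu - b = (a - b) S^2] and [c - mu = c s^2], the square
    roots can be extracted with [C], [S], [s] carrying the signs of [x], [y], [z]. *)
Definition Xr (s : R) : R := sqrt (a * (a + mu s) / (a + c)).
Definition Yr (s : R) : R := sqrt (b * (b + mu s) / (b + c)).
Definition Zr (C S : R) : R := c * sqrt ((c + nu C S) / ((a + c) * (b + c))).
(** A pair [(C, S)] on the unit circle stands for the angle: identities become algebraic modulo
    [C^2 + S^2 = 1], and inverting the chart requires no branch of the angle. *)
Definition chart (s C S : R) : R3 := pt (Xr s * C) (Yr s * S) (Zr C S * s).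

(* Image of the tangent vector [(p, q)] under the differential of
   [(s, phi) |-> chart s (cos phi) (sin phi)], with [(C, S)] standing for [(cos phi, sin phi)]. *)
Definition push (s C S p q : R) : R3 :=
  pt (p * (- (a * c * s / ((a + c) * Xr s)) * C) + q * (- (Xr s * S)))
     (p * (- (b * c * s / ((b + c) * Yr s)) * S) + q * (Yr s * C))
     (p * Zr C S + q * (c ^ 2 * (a - b) * S * C * s / ((a + c) * (b + c) * Zr C S))).

(* [sqrt] vanishes on negative numbers, so this is continuous on all of [R] and equals
   [c sqrt (1 - s^2) / sqrt ((a + mu s) (b + mu s))] for [-1 <= s <= 1]. *)
Definition dens_s (s : R) : R :=
  c * sqrt (1 - s ^ 2) /
  sqrt ((a + c * sqrt (1 - s ^ 2) ^ 2) * (b + c * sqrt (1 - s ^ 2) ^ 2)).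
Definition dens_phi (C S : R) : R := sqrt (nu C S / (c + nu C S)).

Lemma mu_ge0 s : -1 <= s <= 1 -> 0 <= mu s.
Proof. intros H; unfold mu; apply Rmult_le_pos; nra. Qed.

Lemma mu_gt0 s : -1 < s < 1 -> 0 < mu s.
Proof. intros H; unfold mu; apply Rmult_lt_0_compat; nra. Qed.

Lemma nu_bounds C S : C ^ 2 + S ^ 2 = 1 -> b <= nu C S <= a.
Proof. unfold nu; intros H. replace (C ^ 2) with (1 - S ^ 2) by lra.
  pose proof (pow2_ge_0 S); pose proof (pow2_ge_0 C). split; nra. Qed.

Lemma pos_sqrt_quot u v : 0 < u -> 0 < v ->
  0 < sqrt (u / v) /\ sqrt (u / v) ^ 2 = u / v.
Proof.
  intros Hu Hv. assert (0 < u / v) by now apply Rdiv_lt_0_compat.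
  split; [now apply sqrt_lt_R0 | apply pow2_sqrt; lra].
Qed.

Lemma Xr_spec s : -1 <= s <= 1 -> 0 < Xr s /\ Xr s ^ 2 = a * (a + mu s) / (a + c).
Proof. intros H; pose proof (mu_ge0 s H). apply pos_sqrt_quot; nra. Qed.

Lemma Yr_spec s : -1 <= s <= 1 -> 0 < Yr s /\ Yr s ^ 2 = b * (b + mu s) / (b + c).
Proof. intros H; pose proof (mu_ge0 s H). apply pos_sqrt_quot; nra. Qed.

Lemma Zr_spec C S : C ^ 2 + S ^ 2 = 1 ->
  0 < Zr C S /\ Zr C S ^ 2 = c ^ 2 * (c + nu C S) / ((a + c) * (b + c)).
Proof.
  intros H; pose proof (nu_bounds C S H).
  destruct (pos_sqrt_quot (c + nu C S) ((a + c) * (b + c))) as [H1 H2]; try nra.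
  unfold Zr; split; [nra | rewrite Rpow_mult_distr, H2; field; nra].
Qed.

Lemma sqrt_1m_sq s : -1 <= s <= 1 -> sqrt (1 - s ^ 2) ^ 2 = 1 - s ^ 2.
Proof. intros; apply pow2_sqrt; nra. Qed.

Lemma dens_s_sq s : -1 <= s <= 1 ->
  dens_s s ^ 2 = c * mu s / ((a + mu s) * (b + mu s)).
Proof.
  intros H; pose proof (mu_ge0 s H). unfold dens_s.
  rewrite sqrt_1m_sq by easy. fold (mu s).
  unfold Rdiv. rewrite Rpow_mult_distr, pow_inv, Rpow_mult_distr, sqrt_1m_sq, pow2_sqrt
    by (easy || (apply Rmult_le_pos; lra)).
  unfold mu in *; field; split; lra.
Qed.

Lemma dens_s_gt0 s : -1 < s < 1 -> 0 < dens_s s.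
Proof.
  intros H. unfold dens_s.
  assert (0 < sqrt (1 - s ^ 2)) by (apply sqrt_lt_R0; nra).
  apply Rdiv_lt_0_compat; [nra|].
  apply sqrt_lt_R0. pose proof (pow2_ge_0 (sqrt (1 - s ^ 2))). apply Rmult_lt_0_compat; nra.
Qed.

Lemma dens_phi_spec C S : C ^ 2 + S ^ 2 = 1 ->
  0 < dens_phi C S /\ dens_phi C S ^ 2 = nu C S / (c + nu C S).
Proof. intros H; pose proof (nu_bounds C S H). apply pos_sqrt_quot; lra. Qed.

Lemma chart_ellipsoid s C S : -1 <= s <= 1 -> C ^ 2 + S ^ 2 = 1 ->
  ellipsoid a b c (chart s C S).
Proof.
  intros Hs H; unfold ellipsoid, chart, xc, yc, zc, pt; cbn [fst snd].
  destruct (Xr_spec s Hs) as [_ HX], (Yr_spec s Hs) as [_ HY], (Zr_spec C S H) as [_ HZ].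
  rewrite !Rpow_mult_distr, HX, HY, HZ. unfold mu, nu.
  replace (C ^ 2) with (1 - S ^ 2) by lra. field; lra.
Qed.

Definition belt_form (p : R3) : R := xc p ^ 2 / a ^ 2 + yc p ^ 2 / b ^ 2 - zc p ^ 2 / c ^ 2.

(** As [nu] is at least [b], the form vanishes only where [mu] does, which places the tropics at
    [s = 1] and [s = -1]. It also expresses the product [mu * nu] in Cartesian terms. *)
Lemma chart_belt_form s C S : -1 <= s <= 1 -> C ^ 2 + S ^ 2 = 1 ->
  belt_form (chart s C S) = mu s * nu C S / (a * b * c).
Proof.
  intros Hs H; unfold belt_form, chart, xc, yc, zc, pt; cbn [fst snd].
  destruct (Xr_spec s Hs) as [_ HX], (Yr_spec s Hs) as [_ HY], (Zr_spec C S H) as [_ HZ].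
  rewrite !Rpow_mult_distr, HX, HY, HZ. unfold mu, nu.
  replace (C ^ 2) with (1 - S ^ 2) by lra. field; lra.
Qed.

Lemma chart_trace s C S : -1 <= s <= 1 -> C ^ 2 + S ^ 2 = 1 ->
  xc (chart s C S) ^ 2 + yc (chart s C S) ^ 2 - zc (chart s C S) ^ 2 + c - a - b
  = mu s - nu C S.
Proof.
  intros Hs H; unfold chart, xc, yc, zc, pt; cbn [fst snd].
  destruct (Xr_spec s Hs) as [_ HX], (Yr_spec s Hs) as [_ HY], (Zr_spec C S H) as [_ HZ].
  rewrite !Rpow_mult_distr, HX, HY, HZ. unfold mu, nu.
  replace (C ^ 2) with (1 - S ^ 2) by lra. field; lra.
Qed.

Lemma push_tangent s C S p q : -1 <= s <= 1 -> C ^ 2 + S ^ 2 = 1 ->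
  tangent a b c (chart s C S) (push s C S p q).
Proof.
  intros Hs H; unfold tangent, chart, push, xc, yc, zc, pt; cbn [fst snd].
  destruct (Xr_spec s Hs) as [HX0 HX], (Yr_spec s Hs) as [HY0 HY], (Zr_spec C S H) as [HZ0 HZ].
  (* With [X], [Y], [Z] generic, [field] reaches a form in which the square roots occur only through
     their squares, and these are then replaced. *)
  assert (E : forall X Y Z : R, 0 < X -> 0 < Y -> 0 < Z ->
    X * C * (p * (- (a * c * s / ((a + c) * X)) * C) + q * (- (X * S))) / a +
    Y * S * (p * (- (b * c * s / ((b + c) * Y)) * S) + q * (Y * C)) / b +
    Z * s * (p * Z + q * (c ^ 2 * (a - b) * S * C * s / ((a + c) * (b + c) * Z))) / c
    = p * s * (Z ^ 2 / c - c * C ^ 2 / (a + c) - c * S ^ 2 / (b + c)) +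
      q * C * S * (Y ^ 2 / b - X ^ 2 / a + c * (a - b) * s ^ 2 / ((a + c) * (b + c)))).
  { intros; field; lra. }
  rewrite E, HX, HY, HZ by easy. unfold mu, nu.
  replace (C ^ 2) with (1 - S ^ 2) by lra. field; lra.
Qed.

(** The coordinates are orthogonal, so no term in [p * q] survives, and the metric takes Liouville
    form: null directions are those with [dens_phi * q] equal to plus or minus [dens_s * p]. *)
Lemma push_minkowski s C S p q : -1 <= s <= 1 -> C ^ 2 + S ^ 2 = 1 ->
  minkowski (push s C S p q) (push s C S p q)
  = (mu s + nu C S) * ((dens_phi C S * q) ^ 2 - (dens_s s * p) ^ 2).
Proof.
  intros Hs H; unfold minkowski, push, xc, yc, zc, pt; cbn [fst snd].
  destruct (Xr_spec s Hs) as [HX0 HX], (Yr_spec s Hs) as [HY0 HY], (Zr_spec C S H) as [HZ0 HZ].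
  rewrite !Rpow_mult_distr, dens_s_sq, (proj2 (dens_phi_spec C S H)) by easy.
  pose proof (mu_ge0 s Hs); pose proof (nu_bounds C S H).
  assert (E : forall X Y Z : R, 0 < X -> 0 < Y -> 0 < Z ->
    (p * (- (a * c * s / ((a + c) * X)) * C) + q * (- (X * S))) *
    (p * (- (a * c * s / ((a + c) * X)) * C) + q * (- (X * S))) +
    (p * (- (b * c * s / ((b + c) * Y)) * S) + q * (Y * C)) *
    (p * (- (b * c * s / ((b + c) * Y)) * S) + q * (Y * C)) -
    (p * Z + q * (c ^ 2 * (a - b) * S * C * s / ((a + c) * (b + c) * Z))) *
    (p * Z + q * (c ^ 2 * (a - b) * S * C * s / ((a + c) * (b + c) * Z)))
    = p ^ 2 * (a ^ 2 * c ^ 2 * s ^ 2 * C ^ 2 / ((a + c) ^ 2 * X ^ 2)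
               + b ^ 2 * c ^ 2 * s ^ 2 * S ^ 2 / ((b + c) ^ 2 * Y ^ 2) - Z ^ 2)
    + q ^ 2 * (X ^ 2 * S ^ 2 + Y ^ 2 * C ^ 2
        - c ^ 4 * (a - b) ^ 2 * S ^ 2 * C ^ 2 * s ^ 2 / (((a + c) * (b + c)) ^ 2 * Z ^ 2))).
  { intros; field; lra. }
  rewrite E, HX, HY, HZ by easy.
  assert (N1 : a + mu s <> 0) by lra. assert (N2 : b + mu s <> 0) by lra.
  assert (N3 : c + nu C S <> 0) by lra.
  unfold mu, nu in *.
  replace (C ^ 2) with (1 - S ^ 2) in * by lra. field; repeat split; try lra.
  all: intros K; (apply N1 + apply N2 + apply N3); lra.
Qed.

(** Both null directions, oriented towards increasing [s], also increase the height. This yields the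
    monotonicity of [z] required by [right_up], and the nonvanishing of [null_vec] up to the
    tropics. *)
Lemma push_null_z s C S e : -1 <= s <= 1 -> C ^ 2 + S ^ 2 = 1 -> e ^ 2 = 1 ->
  0 < zc (push s C S (dens_phi C S) (e * dens_s s)).
Proof.
  intros Hs H He. unfold push, zc, pt; cbn [fst snd].
  destruct (Zr_spec C S H) as [HZ0 HZ], (dens_phi_spec C S H) as [HB0 HB].
  pose proof (dens_s_sq s Hs) as HA.
  pose proof (mu_ge0 s Hs) as Hm; pose proof (nu_bounds C S H) as Hn.
  set (B := dens_phi C S) in *; set (A := dens_s s) in *. set (Z := Zr C S) in *.
  set (t := e * A * (a - b) * S * C * s).
  assert (E : B * Z + e * A * (c ^ 2 * (a - b) * S * C * s / ((a + c) * (b + c) * Z))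
     = (c ^ 2 / ((a + c) * (b + c))) * (B * (c + nu C S) + t) / Z).
  { transitivity ((B * Z ^ 2 + c ^ 2 / ((a + c) * (b + c)) * t) / Z).
    - unfold t; field; lra.
    - rewrite HZ; field; lra. }
  rewrite E; clear E.
  apply Rdiv_lt_0_compat; [|easy].
  apply Rmult_lt_0_compat; [apply Rdiv_lt_0_compat; nra|].
  assert (HT : 0 < B * (c + nu C S)) by nra.
  (* Squaring reduces the claim to
     [mu (c - mu) (a - nu) (nu - b) < nu (c + nu) (a + mu) (b + mu)]. *)
  cut (t ^ 2 < (B * (c + nu C S)) ^ 2); [nra|].
  assert (Et : t ^ 2 = (c * s ^ 2) * mu s * (nu C S - b) * (a - nu C S)
                       / ((a + mu s) * (b + mu s))).
  { unfold t. rewrite !Rpow_mult_distr, He, HA. unfold nu.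
    replace (C ^ 2) with (1 - S ^ 2) by lra. field; lra. }
  assert (ET : (B * (c + nu C S)) ^ 2 = nu C S * (c + nu C S)).
  { rewrite Rpow_mult_distr, HB; field; lra. }
  rewrite Et, ET. set (m := mu s) in *; set (n := nu C S) in *.
  apply (Rmult_lt_reg_r ((a + m) * (b + m))); [apply Rmult_lt_0_compat; lra|].
  replace (c * s ^ 2 * m * (n - b) * (a - n) / ((a + m) * (b + m)) * ((a + m) * (b + m)))
    with ((c * s ^ 2 * m) * ((n - b) * (a - n))) by (field; lra).
  replace (n * (c + n) * ((a + m) * (b + m)))
    with (((c + n) * (b + m)) * (n * (a + m))) by ring.
  (* The factors are compared in pairs: [c * s^2 * m] with [(c + n) * (b + m)], and
     [(n - b) * (a - n)] with [n * (a + m)]. *)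
  apply Rmult_le_0_lt_compat.
  - apply Rmult_le_pos; [nra | easy].
  - apply Rmult_le_pos; lra.
  - apply Rle_lt_trans with (c * m); [|nra].
    apply Rmult_le_compat_r; [easy|]. rewrite <- (Rmult_1_r c) at 2.
    apply Rmult_le_compat_l; nra.
  - assert (0 <= a - n) by lra. nra.
Qed.

(** * Coordinates of tangent vectors *)

(** The weights [(b + mu) / Yr] and [(a + mu) / Xr] make the contributions of [p] to the two
    horizontal components of [push] cancel and leave [(mu + nu) * q]. Then [coord_s] reads [p] off
    the vertical component. *)
Definition coord_phi (s C S : R) (w : R3) : R :=
  (C * yc w * (b + mu s) / Yr s - S * xc w * (a + mu s) / Xr s) / (mu s + nu C S).
Definition coord_s (s C S : R) (w : R3) : R :=
  (zc w - coord_phi s C S w * (c ^ 2 * (a - b) * S * C * s / ((a + c) * (b + c) * Zr C S)))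
  / Zr C S.

Lemma coord_phi_push s C S p q : -1 <= s <= 1 -> C ^ 2 + S ^ 2 = 1 ->
  coord_phi s C S (push s C S p q) = q.
Proof.
  intros Hs H; unfold coord_phi, push, xc, yc, pt; cbn [fst snd].
  destruct (Xr_spec s Hs) as [HX0 HX], (Yr_spec s Hs) as [HY0 HY].
  pose proof (mu_ge0 s Hs); pose proof (nu_bounds C S H).
  assert (E : forall X Y m : R, 0 < X -> 0 < Y ->
    C * (p * (- (b * c * s / ((b + c) * Y)) * S) + q * (Y * C)) * (b + m) / Y -
    S * (p * (- (a * c * s / ((a + c) * X)) * C) + q * (- (X * S))) * (a + m) / X
    = p * C * S * c * s * ((a * (a + m) / (a + c)) / X ^ 2 - (b * (b + m) / (b + c)) / Y ^ 2)
      + q * (m * (C ^ 2 + S ^ 2) + (a * S ^ 2 + b * C ^ 2))).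
  { intros; field; lra. }
  rewrite E, <- HX, <- HY, H by easy. fold (nu C S). field; repeat split; lra.
Qed.

Lemma coord_s_push s C S p q : -1 <= s <= 1 -> C ^ 2 + S ^ 2 = 1 ->
  coord_s s C S (push s C S p q) = p.
Proof.
  intros Hs H; unfold coord_s; rewrite coord_phi_push by easy.
  destruct (Zr_spec C S H) as [HZ0 HZ].
  unfold push, zc, pt; cbn [fst snd]. field; lra.
Qed.

(** Both vectors are tangent and share their height and their [coord_phi]. The difference of their
    horizontal parts, suitably rescaled, solves a homogeneous 2 by 2 system with determinant
    [C^2 / (a + c) + S^2 / (b + c) > 0]. *)
Lemma push_coords s C S w : -1 <= s <= 1 -> C ^ 2 + S ^ 2 = 1 ->
  tangent a b c (chart s C S) w ->
  push s C S (coord_s s C S w) (coord_phi s C S w) = w.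
Proof.
  intros Hs H Hw.
  pose proof (push_tangent s C S (coord_s s C S w) (coord_phi s C S w) Hs H) as Hv.
  pose proof (coord_phi_push s C S (coord_s s C S w) (coord_phi s C S w) Hs H) as Ho.
  destruct (Xr_spec s Hs) as [HX0 HX], (Yr_spec s Hs) as [HY0 HY], (Zr_spec C S H) as [HZ0 HZ].
  pose proof (mu_ge0 s Hs) as Hm; pose proof (nu_bounds C S H) as Hn.
  assert (Hz : zc (push s C S (coord_s s C S w) (coord_phi s C S w)) = zc w).
  { unfold push, zc at 1, pt; cbn [fst snd]. unfold coord_s; field; lra. }
  revert Hv Ho Hz; generalize (push s C S (coord_s s C S w) (coord_phi s C S w)).
  destruct w as [[wx wy] wz]; intros [[vx vy] vz]; unfold coord_phi, tangent, chart, xc, yc, zc, pt in *;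
    cbn [fst snd] in *; intros Hv Ho Hz; subst vz.
  set (u := (vx - wx) / Xr s). set (v := (vy - wy) / Yr s).
  assert (E1 : C * (u * (a + mu s)) / (a + c) + S * (v * (b + mu s)) / (b + c) = 0).
  { transitivity (C * u * (a * (a + mu s) / (a + c)) / a + S * v * (b * (b + mu s) / (b + c)) / b).
    - field; lra.
    - rewrite <- HX, <- HY. unfold u, v.
      match type of Hv with ?l = _ => match type of Hw with ?r = _ =>
        replace 0 with (l - r) by lra end end. field; lra. }
  assert (E2 : C * (v * (b + mu s)) = S * (u * (a + mu s))).
  { apply (f_equal (fun t => t * (mu s + nu C S))) in Ho.
    unfold Rdiv in Ho at 1 4. rewrite !Rmult_assoc, Rinv_l, !Rmult_1_r in Ho by lra.
    unfold u, v. revert Ho; unfold Rdiv; intros Ho. lra. }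
  set (U := u * (a + mu s)) in *; set (V := v * (b + mu s)) in *.
  assert (HD : 0 < C ^ 2 / (a + c) + S ^ 2 / (b + c)).
  { assert (0 < / (a + c)) by (apply Rinv_0_lt_compat; lra).
    assert (0 < / (b + c)) by (apply Rinv_0_lt_compat; lra).
    unfold Rdiv. pose proof (pow2_ge_0 C); pose proof (pow2_ge_0 S).
    destruct (Rle_lt_or_eq_dec 0 (C ^ 2) (pow2_ge_0 C)) as [|K]; [nra|].
    rewrite <- K in *. nra. }
  assert (HU : U * (C ^ 2 / (a + c) + S ^ 2 / (b + c)) = 0).
  { transitivity (C * (C * U / (a + c) + S * V / (b + c)) - S * (C * V - S * U) / (b + c)).
    - field; lra.
    - rewrite E1, E2; field; lra. }
  assert (HV : V * (C ^ 2 / (a + c) + S ^ 2 / (b + c)) = 0).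
  { transitivity (S * (C * U / (a + c) + S * V / (b + c)) + C * (C * V - S * U) / (a + c)).
    - field; lra.
    - rewrite E1, E2; field; lra. }
  apply Rmult_integral in HU; destruct HU as [HU|]; [|lra].
  apply Rmult_integral in HV; destruct HV as [HV|]; [|lra].
  unfold U in HU; unfold V in HV.
  apply Rmult_integral in HU; destruct HU as [HU|]; [|lra].
  apply Rmult_integral in HV; destruct HV as [HV|]; [|lra].
  assert (vx - wx = u * Xr s) by (unfold u; field; lra).
  assert (vy - wy = v * Yr s) by (unfold v; field; lra).
  rewrite HU in *; rewrite HV in *. f_equal; f_equal; lra.
Qed.

(* [mu] and [- nu] are the confocal coordinates of a point: their sum and product are
   polynomials in the Cartesian coordinates. *)
Definition conf_sum (p : R3) : R := xc p ^ 2 + yc p ^ 2 - zc p ^ 2 + c - a - b.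
Definition conf_disc (p : R3) : R := sqrt (conf_sum p ^ 2 + 4 * (a * b * c * belt_form p)).
Definition mu_of (p : R3) : R := (conf_disc p + conf_sum p) / 2.
Definition nu_of (p : R3) : R := (conf_disc p - conf_sum p) / 2.
Definition s_of (p : R3) : R := zc p / (c * sqrt ((c + nu_of p) / ((a + c) * (b + c)))).
Definition C_of (p : R3) : R := xc p / sqrt (a * (a + mu_of p) / (a + c)).
Definition S_of (p : R3) : R := yc p / sqrt (b * (b + mu_of p) / (b + c)).

Lemma conf_disc_chart s C S : -1 <= s <= 1 -> C ^ 2 + S ^ 2 = 1 ->
  conf_disc (chart s C S) = mu s + nu C S.
Proof.
  intros Hs H. unfold conf_disc, conf_sum. rewrite chart_trace, chart_belt_form by easy.
  pose proof (mu_ge0 s Hs) as Hm; pose proof (nu_bounds C S H) as Hn.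
  rewrite <- (sqrt_pow2 (mu s + nu C S)) by lra. f_equal. field; lra.
Qed.

Lemma mu_of_chart s C S : -1 <= s <= 1 -> C ^ 2 + S ^ 2 = 1 -> mu_of (chart s C S) = mu s.
Proof.
  intros Hs H; unfold mu_of; rewrite conf_disc_chart by easy.
  unfold conf_sum; rewrite chart_trace by easy; field.
Qed.

Lemma nu_of_chart s C S : -1 <= s <= 1 -> C ^ 2 + S ^ 2 = 1 -> nu_of (chart s C S) = nu C S.
Proof.
  intros Hs H; unfold nu_of; rewrite conf_disc_chart by easy.
  unfold conf_sum; rewrite chart_trace by easy; field.
Qed.

Lemma of_chart s C S : -1 <= s <= 1 -> C ^ 2 + S ^ 2 = 1 ->
  s_of (chart s C S) = s /\ C_of (chart s C S) = C /\ S_of (chart s C S) = S.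
Proof.
  intros Hs H; unfold s_of, C_of, S_of. rewrite mu_of_chart, nu_of_chart by easy.
  fold (Xr s) (Yr s) (Zr C S).
  pose proof (proj1 (Xr_spec s Hs)); pose proof (proj1 (Yr_spec s Hs)).
  pose proof (proj1 (Zr_spec C S H)).
  unfold chart, xc, yc, zc, pt; cbn [fst snd]. repeat split; field; lra.
Qed.

Definition closed_belt (p : R3) : Prop := ellipsoid a b c p /\ 0 <= belt_form p.


(** The quadratic [(x - mu) (x + nu)] has coefficients polynomial in the Cartesian coordinates.
    Evaluating it at [- a], [- b] and [c], with [z] eliminated through the equation of the
    ellipsoid, gives the three products. *)
Lemma conf_of_closed_belt p : closed_belt p ->
  0 <= mu_of p /\ 0 <= nu_of p /\
  (a + mu_of p) * (a - nu_of p) = xc p ^ 2 / a * ((a - b) * (a + c)) /\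
  (b + mu_of p) * (nu_of p - b) = yc p ^ 2 / b * ((a - b) * (b + c)) /\
  (c - mu_of p) * (c + nu_of p) = zc p ^ 2 / c * ((a + c) * (b + c)).
Proof.
  intros [He Hf].
  assert (HP : 0 <= a * b * c * belt_form p).
  { apply Rmult_le_pos; [apply Rlt_le; repeat apply Rmult_lt_0_compat|]; easy. }
  assert (HD : conf_disc p ^ 2 = conf_sum p ^ 2 + 4 * (a * b * c * belt_form p)).
  { apply pow2_sqrt. pose proof (pow2_ge_0 (conf_sum p)). lra. }
  assert (HD0 : 0 <= conf_disc p) by apply sqrt_pos.
  assert (Hp : mu_of p * nu_of p = a * b * c * belt_form p) by (unfold mu_of, nu_of; nra).
  assert (Hs : mu_of p - nu_of p = conf_sum p) by (unfold mu_of, nu_of; field).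
  assert (0 <= mu_of p) by (unfold mu_of; nra).
  assert (0 <= nu_of p) by (unfold nu_of; nra).
  split; [easy|split; [easy|]].
  unfold ellipsoid in He. unfold belt_form, conf_sum in *.
  set (u := xc p ^ 2 / a) in *; set (v := yc p ^ 2 / b) in *; set (w := zc p ^ 2 / c) in *.
  assert (Ex : xc p ^ 2 = a * u) by (unfold u; field; lra).
  assert (Ey : yc p ^ 2 = b * v) by (unfold v; field; lra).
  assert (Ez : zc p ^ 2 = c * w) by (unfold w; field; lra).
  rewrite Ex, Ey, Ez in *.
  assert (Ep : mu_of p * nu_of p = b * c * u + a * c * v - a * b * w).
  { rewrite Hp; field; lra. }
  assert (Ew : w = 1 - u - v) by lra. rewrite Ew in *.
  repeat split.
  - transitivity (a ^ 2 + a * (mu_of p - nu_of p) - mu_of p * nu_of p); [ring|].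
    rewrite Hs, Ep; ring.
  - transitivity (- b ^ 2 - b * (mu_of p - nu_of p) + mu_of p * nu_of p); [ring|].
    rewrite Hs, Ep; ring.
  - transitivity (c ^ 2 - c * (mu_of p - nu_of p) - mu_of p * nu_of p); [ring|].
    rewrite Hs, Ep; ring.
Qed.

(** The preceding products determine [C_of^2], [S_of^2] and [s_of^2], whence [mu] and [nu] of the
    recovered coordinates are [mu_of] and [nu_of], and the roots in the chart cancel the divisions.
    Dividing by [a - b] uses [b < a]. *)
Lemma chart_of p : closed_belt p ->
  -1 <= s_of p <= 1 /\ C_of p ^ 2 + S_of p ^ 2 = 1 /\
  chart (s_of p) (C_of p) (S_of p) = p.
Proof.
  intros Hp. destruct (conf_of_closed_belt p Hp) as (Hm & Hn & Ex & Ey & Ez).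
  destruct (pos_sqrt_quot (a * (a + mu_of p)) (a + c)) as [HX0 HX]; try nra.
  destruct (pos_sqrt_quot (b * (b + mu_of p)) (b + c)) as [HY0 HY]; try nra.
  destruct (pos_sqrt_quot (c + nu_of p) ((a + c) * (b + c))) as [HZ0 HZ]; try nra.
  assert (EC : C_of p ^ 2 = (a - nu_of p) / (a - b)).
  { unfold C_of, Rdiv at 1. rewrite Rpow_mult_distr, pow_inv, HX.
    replace (xc p ^ 2) with (a * ((a + mu_of p) * (a - nu_of p)) / ((a - b) * (a + c))).
    - field; lra.
    - rewrite Ex; field; lra. }
  assert (ES : S_of p ^ 2 = (nu_of p - b) / (a - b)).
  { unfold S_of, Rdiv at 1. rewrite Rpow_mult_distr, pow_inv, HY.
    replace (yc p ^ 2) with (b * ((b + mu_of p) * (nu_of p - b)) / ((a - b) * (b + c))).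
    - field; lra.
    - rewrite Ey; field; lra. }
  assert (Es : s_of p ^ 2 = (c - mu_of p) / c).
  { unfold s_of, Rdiv at 1. rewrite Rpow_mult_distr, pow_inv, Rpow_mult_distr, HZ.
    replace (zc p ^ 2) with (c * ((c - mu_of p) * (c + nu_of p)) / ((a + c) * (b + c))).
    - field; lra.
    - rewrite Ez; field; lra. }
  assert (Em : mu (s_of p) = mu_of p) by (unfold mu; rewrite Es; field; lra).
  assert (En : nu (C_of p) (S_of p) = nu_of p) by (unfold nu; rewrite EC, ES; field; lra).
  split; [|split].
  - assert (mu_of p / c >= 0) by (apply Rle_ge, Rdiv_le_0_compat; lra).
    assert (Es' : s_of p ^ 2 = 1 - mu_of p / c) by (rewrite Es; field; lra).
    split; nra.
  - rewrite EC, ES; field; lra.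
  - unfold chart, Xr, Yr, Zr. rewrite Em, En. unfold s_of, C_of, S_of.
    destruct p as [[x y] z]; unfold pt, xc, yc, zc in *; cbn [fst snd] in *.
    f_equal; [f_equal|]; field; lra.
Qed.


(** * The two quadratures and the differential of the chart *)

Definition alpha (s : R) : R := RInt dens_s 0 s.
Definition beta (t : R) : R := RInt (fun u => dens_phi (cos u) (sin u)) 0 t.
Definition loc (s t : R) : R3 := chart s (cos t) (sin t).

Lemma circle t : cos t ^ 2 + sin t ^ 2 = 1.
Proof. pose proof (sin2_cos2 t); unfold Rsqr in *; lra. Qed.

Lemma continuous_dens_s s : continuous dens_s s.
Proof.
  unfold dens_s; cont.
  assert (0 <= c * sqrt (1 - s ^ 2) ^ 2) by (apply Rmult_le_pos; [lra | apply pow2_ge_0]).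
  apply Rgt_not_eq, sqrt_lt_R0, Rmult_lt_0_compat; lra.
Qed.

Lemma continuous_dens_phi {U : UniformSpace} (C S : U -> R) (x : U) :
  continuous C x -> continuous S x -> C x ^ 2 + S x ^ 2 = 1 ->
  continuous (fun u => dens_phi (C u) (S u)) x.
Proof.
  intros HC HS H. pose proof (nu_bounds (C x) (S x) H) as Hn. unfold nu in Hn.
  unfold dens_phi, nu; cont. lra.
Qed.

(** Fundamental theorem of calculus; it applies at every real [s], the tropics included, because
    [dens_s] is continuous on the whole line. *)
Lemma is_derive_alpha s : is_derive alpha s (dens_s s).
Proof.
  apply (is_derive_RInt dens_s alpha 0 s); [|apply continuous_dens_s].
  apply filter_forall; intros x. apply (RInt_correct (V := R_CompleteNormedModule)).
  apply (ex_RInt_continuous (V := R_CompleteNormedModule)). intros; apply continuous_dens_s.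
Qed.

Lemma is_derive_beta t : is_derive beta t (dens_phi (cos t) (sin t)).
Proof.
  assert (Hc : forall u, continuous (fun u => dens_phi (cos u) (sin u)) u).
  { intros u; apply continuous_dens_phi;
      [apply continuous_cos | apply continuous_sin | apply circle]. }
  apply (is_derive_RInt (fun u => dens_phi (cos u) (sin u)) beta 0 t); [|apply Hc].
  apply filter_forall; intros x. apply (RInt_correct (V := R_CompleteNormedModule)).
  apply (ex_RInt_continuous (V := R_CompleteNormedModule)). intros; apply Hc.
Qed.

Lemma continuous_alpha s : continuous alpha s.
Proof. apply (ex_derive_continuous (V := R_NormedModule)). eexists; apply is_derive_alpha. Qed.

Lemma continuous_beta t : continuous beta t.
Proof. apply (ex_derive_continuous (V := R_NormedModule)). eexists; apply is_derive_beta. Qed.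

Lemma beta_inverse : exists g : R -> R,
  (forall y, beta (g y) = y) /\ (forall t, g (beta t) = t) /\
  (forall y, is_derive g y (/ dens_phi (cos (g y)) (sin (g y)))).
Proof.
  (* The lower bound for the density comes from [nu >= b] in the numerator and [nu <= a] in the
     denominator. *)
  apply (inverse_of_expanding beta (fun t => dens_phi (cos t) (sin t)) (sqrt (b / (c + a)))).
  - apply sqrt_lt_R0, Rdiv_lt_0_compat; lra.
  - apply is_derive_beta.
  - intros t. pose proof (nu_bounds _ _ (circle t)). apply sqrt_le_1_alt.
    apply Rmult_le_compat; try lra.
    + apply Rlt_le, Rinv_0_lt_compat; lra.
    + apply Rinv_le_contravar; lra.
Qed.

Lemma beta_inj t t' : beta t = beta t' -> t = t'.
Proof.
  destruct beta_inverse as (g & _ & Hg & _). intros E.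
  rewrite <- (Hg t), <- (Hg t'). now rewrite E.
Qed.

(** The integrand has period [2 * PI], so the increment over one turn has derivative zero; its value
    is read off at 0. *)
Lemma beta_period t : beta (t + 2 * PI) = beta t + beta (2 * PI).
Proof.
  assert (Hd : forall u, is_derive (fun u => beta (u + 2 * PI) - beta u) u 0).
  { intros u. pose proof (is_derive_beta u) as H1. pose proof (is_derive_beta (u + 2 * PI)) as H2.
    rewrite cos_plus, sin_plus, cos_2PI, sin_2PI in H2.
    rewrite !Rmult_1_r, !Rmult_0_r, Rminus_0_r, Rplus_0_r in H2.
    auto_derive.
    - repeat split; eexists; [exact H2 | exact H1].
    - rewrite (is_derive_unique (fun x : R => beta x) _ _ H1),
        (is_derive_unique (fun x : R => beta x) _ _ H2). ring. }
  assert (E : forall u v, u <= v -> beta (u + 2 * PI) - beta u = beta (v + 2 * PI) - beta v).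
  { intros u v Huv. apply (constant_of_derive_0 (fun u => beta (u + 2 * PI) - beta u)); [easy| |].
    - intros x _. apply (ex_derive_continuous (V := R_NormedModule)). eexists; apply Hd.
    - intros; apply Hd. }
  assert (E0 : beta 0 = 0) by (unfold beta; apply (RInt_point (V := R_CompleteNormedModule))).
  assert (K : beta (t + 2 * PI) - beta t = beta (0 + 2 * PI) - beta 0).
  { destruct (Rle_dec t 0); [apply E; lra | symmetry; apply E; lra]. }
  rewrite Rplus_0_l in K. lra.
Qed.

Lemma beta_periodZ t k : beta (t + IZR k * (2 * PI)) = beta t + IZR k * beta (2 * PI).
Proof.
  assert (N : forall n t, beta (t + INR n * (2 * PI)) = beta t + INR n * beta (2 * PI)).
  { induction n as [|n IH]; intros u; [simpl; rewrite !Rmult_0_l, !Rplus_0_r; easy|].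
    rewrite S_INR. replace (u + (INR n + 1) * (2 * PI)) with (u + INR n * (2 * PI) + 2 * PI) by ring.
    rewrite beta_period, IH; ring. }
  destruct (Z.le_gt_cases 0 k) as [Hk|Hk].
  - rewrite <- (Z2Nat.id k Hk), <- INR_IZR_INZ. apply N.
  (* For negative [k], the case of natural numbers is applied from the shifted point back to [t]. *)
  - pose proof (N (Z.to_nat (- k)) (t + IZR k * (2 * PI))) as E.
    rewrite INR_IZR_INZ, Z2Nat.id, opp_IZR in E by lia.
    replace (t + IZR k * (2 * PI) + - IZR k * (2 * PI)) with t in E by ring. lra.
Qed.

Lemma loc_period s t k : loc s (t + IZR k * (2 * PI)) = loc s t.
Proof.
  unfold loc. replace (IZR k * (2 * PI)) with (2 * IZR k * PI) by ring.
  assert (N : forall n t, cos (t + INR n * (2 * PI)) = cos t /\ sin (t + INR n * (2 * PI)) = sin t).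
  { intros n u. replace (INR n * (2 * PI)) with (2 * INR n * PI) by ring.
    split; [apply cos_period | apply sin_period]. }
  destruct (Z.le_gt_cases 0 k) as [Hk|Hk].
  - rewrite <- (Z2Nat.id k Hk), <- INR_IZR_INZ. now rewrite cos_period, sin_period.
  - destruct (N (Z.to_nat (- k)) (t + 2 * IZR k * PI)) as [E1 E2].
    rewrite INR_IZR_INZ, Z2Nat.id, opp_IZR in E1, E2 by lia.
    replace (t + 2 * IZR k * PI + - IZR k * (2 * PI)) with t in E1, E2 by ring.
    now rewrite E1, E2.
Qed.

(** The radicand stays positive at [s = 1] and [s = -1], so the chart is differentiable at the
    tropics as well. *)
Lemma is_derive_Xr s : -1 <= s <= 1 -> is_derive Xr s (- (a * c * s / ((a + c) * Xr s))).
Proof.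
  intros Hs; pose proof (mu_ge0 s Hs) as Hm. destruct (Xr_spec s Hs) as [HX0 HX].
  assert (0 < a * (a + mu s) / (a + c)) by (apply Rdiv_lt_0_compat; nra).
  apply (is_derive_ext (fun s => sqrt (a * (a + c * (1 - s ^ 2)) / (a + c)))); [easy|].
  auto_derive; [easy|].
  replace (1 + - (s * (s * 1))) with (1 - s ^ 2) by ring.
  fold (mu s). fold (Rdiv (a * (a + mu s)) (a + c)). fold (Xr s). field; lra.
Qed.

Lemma is_derive_Yr s : -1 <= s <= 1 -> is_derive Yr s (- (b * c * s / ((b + c) * Yr s))).
Proof.
  intros Hs; pose proof (mu_ge0 s Hs) as Hm. destruct (Yr_spec s Hs) as [HY0 HY].
  assert (0 < b * (b + mu s) / (b + c)) by (apply Rdiv_lt_0_compat; nra).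
  apply (is_derive_ext (fun s => sqrt (b * (b + c * (1 - s ^ 2)) / (b + c)))); [easy|].
  auto_derive; [easy|].
  replace (1 + - (s * (s * 1))) with (1 - s ^ 2) by ring.
  fold (mu s). fold (Rdiv (b * (b + mu s)) (b + c)). fold (Yr s). field; lra.
Qed.

Lemma is_derive_Zr t : is_derive (fun t => Zr (cos t) (sin t)) t
  (c ^ 2 * (a - b) * sin t * cos t / ((a + c) * (b + c) * Zr (cos t) (sin t))).
Proof.
  destruct (Zr_spec _ _ (circle t)) as [HZ0 HZ]. pose proof (nu_bounds _ _ (circle t)) as Hn.
  unfold Zr in *. set (K := (a + c) * (b + c)) in *.
  assert (HK : 0 < K) by (apply Rmult_lt_0_compat; lra).
  unfold nu in *.
  assert (Hp : 0 < (c + (a * sin t ^ 2 + b * cos t ^ 2)) / K) by (apply Rdiv_lt_0_compat; lra).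
  assert (Hq : 0 < sqrt ((c + (a * sin t ^ 2 + b * cos t ^ 2)) / K)) by now apply sqrt_lt_R0.
  auto_derive; [easy|].
  change (cos t * (cos t * 1)) with (cos t ^ 2). change (sin t * (sin t * 1)) with (sin t ^ 2).
  fold (Rdiv (c + (a * sin t ^ 2 + b * cos t ^ 2)) K). field; lra.
Qed.

Lemma is_derive_loc (f g : R -> R) (t df dg : R) : -1 <= f t <= 1 ->
  is_derive f t df -> is_derive g t dg ->
  is_derive (fun u => loc (f u) (g u)) t (push (f t) (cos (g t)) (sin (g t)) df dg).
Proof.
  intros Hs Hf Hg.
  pose proof (is_derive_Xr _ Hs) as HX; pose proof (is_derive_Yr _ Hs) as HY.
  pose proof (is_derive_Zr (g t)) as HZ.
  apply is_derive_R3; unfold loc, chart, push, xc, yc, zc, pt; cbn [fst snd].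
  set (Z := fun t => Zr (cos t) (sin t)) in *.
  split; [|split].
  - auto_derive.
    + repeat split; eexists; eassumption.
    + rewrite (is_derive_unique (fun x : R => Xr x) _ _ HX),
        (is_derive_unique (fun x : R => f x) _ _ Hf), (is_derive_unique (fun x : R => g x) _ _ Hg).
      ring.
  - auto_derive.
    + repeat split; eexists; eassumption.
    + rewrite (is_derive_unique (fun x : R => Yr x) _ _ HY),
        (is_derive_unique (fun x : R => f x) _ _ Hf), (is_derive_unique (fun x : R => g x) _ _ Hg).
      ring.
  - apply (is_derive_ext (fun u => Z (g u) * f u)); [easy|]. auto_derive.
    + repeat split; eexists; eassumption.
    + rewrite (is_derive_unique (fun x : R => Z x) _ _ HZ),
        (is_derive_unique (fun x : R => f x) _ _ Hf), (is_derive_unique (fun x : R => g x) _ _ Hg).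
      unfold Z. unfold Rdiv. ring.
Qed.

(** * Regularity of the inverse coordinates *)

Lemma conf_pos p : closed_belt p ->
  0 < conf_sum p ^ 2 + 4 * (a * b * c * belt_form p) /\
  0 < a * (a + mu_of p) / (a + c) /\ 0 < b * (b + mu_of p) / (b + c) /\
  0 < (c + nu_of p) / ((a + c) * (b + c)).
Proof.
  intros Hp. destruct (chart_of p Hp) as (Hs & H & E).
  pose proof (mu_ge0 _ Hs) as Hm; pose proof (nu_bounds _ _ H) as Hn.
  pose proof (mu_of_chart _ _ _ Hs H) as Em; pose proof (nu_of_chart _ _ _ Hs H) as En.
  pose proof (conf_disc_chart _ _ _ Hs H) as Ed.
  rewrite E in Em, En, Ed. rewrite Em, En.
  repeat split; try (apply Rdiv_lt_0_compat; try apply Rmult_lt_0_compat; lra).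
  (* A nonpositive radicand would give [conf_disc p = 0], while it equals [mu + nu], which is at
     least [b]. *)
  destruct (Rlt_dec 0 (conf_sum p ^ 2 + 4 * (a * b * c * belt_form p))) as [|K]; [easy|].
  unfold conf_disc in Ed. rewrite sqrt_neg_0 in Ed; lra.
Qed.

Lemma continuous_mu_of p : continuous mu_of p.
Proof.
  pose proof (continuous_xc p); pose proof (continuous_yc p); pose proof (continuous_zc p).
  unfold mu_of, conf_disc, conf_sum, belt_form; cont; try apply pow_nonzero; lra.
Qed.

Lemma continuous_nu_of p : continuous nu_of p.
Proof.
  pose proof (continuous_xc p); pose proof (continuous_yc p); pose proof (continuous_zc p).
  unfold nu_of, conf_disc, conf_sum, belt_form; cont; try apply pow_nonzero; lra.
Qed.

Lemma continuous_of p : closed_belt p ->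
  continuous s_of p /\ continuous C_of p /\ continuous S_of p.
Proof.
  intros Hp; destruct (conf_pos p Hp) as (_ & HX & HY & HZ).
  apply sqrt_lt_R0 in HX, HY, HZ.
  pose proof (continuous_xc p); pose proof (continuous_yc p); pose proof (continuous_zc p).
  pose proof (continuous_mu_of p); pose proof (continuous_nu_of p).
  assert ((a + c) * (b + c) <> 0) by (apply Rgt_not_eq, Rmult_lt_0_compat; lra).
  unfold s_of, C_of, S_of; repeat split; cont; try lra; try easy.
  apply Rgt_not_eq, Rmult_lt_0_compat; lra.
Qed.

Lemma ex_derive_of (g : R -> R3) (t : R) : closed_belt (g t) -> ex_derive g t ->
  ex_derive (fun u => s_of (g u)) t /\ ex_derive (fun u => C_of (g u)) t /\
  ex_derive (fun u => S_of (g u)) t.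
Proof.
  intros Hp [v Hv]. destruct (conf_pos _ Hp) as (HD & HX & HY & HZ).
  pose proof (sqrt_lt_R0 _ HX); pose proof (sqrt_lt_R0 _ HY); pose proof (sqrt_lt_R0 _ HZ).
  apply is_derive_R3 in Hv; destruct Hv as (Hx & Hy & Hz).
  assert (Dx : ex_derive (fun u => xc (g u)) t) by (eexists; eassumption).
  assert (Dy : ex_derive (fun u => yc (g u)) t) by (eexists; eassumption).
  assert (Dz : ex_derive (fun u => zc (g u)) t) by (eexists; eassumption).
  assert (Dm : ex_derive (fun u => mu_of (g u)) t)
    by (unfold mu_of, conf_disc, conf_sum, belt_form in *; exd; try apply pow_nonzero; lra).
  assert (Dn : ex_derive (fun u => nu_of (g u)) t)
    by (unfold nu_of, conf_disc, conf_sum, belt_form in *; exd; try apply pow_nonzero; lra).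
  assert (0 < c * sqrt ((c + nu_of (g t)) / ((a + c) * (b + c)))) by (now apply Rmult_lt_0_compat).
  assert (0 < (a + c) * (b + c)) by (apply Rmult_lt_0_compat; lra).
  unfold s_of, C_of, S_of; repeat split; exd; lra.
Qed.

(** * The open belt in coordinates and the sign of a null line field *)

Lemma belt_closed p : belt a b c p -> closed_belt p.
Proof. intros [H1 H2]; split; [easy | unfold belt_form; lra]. Qed.

Lemma belt_loc s t : -1 < s < 1 -> belt a b c (loc s t).
Proof.
  intros Hs. split; [apply chart_ellipsoid; [lra | apply circle]|].
  change (belt_form (loc s t) > 0). unfold loc. rewrite chart_belt_form; [|lra|apply circle].
  pose proof (mu_gt0 s Hs); pose proof (nu_bounds _ _ (circle t)).
  apply Rdiv_lt_0_compat; [|repeat apply Rmult_lt_0_compat; easy].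
  apply Rmult_lt_0_compat; lra.
Qed.

Lemma belt_inv p : belt a b c p -> exists t, -1 < s_of p < 1 /\
  C_of p = cos t /\ S_of p = sin t /\ p = loc (s_of p) t.
Proof.
  intros Hp. destruct (chart_of p (belt_closed p Hp)) as (Hs & H & E).
  destruct (polar _ _ H) as (t & Hc & Ht). exists t.
  unfold loc; rewrite Hc, Ht. repeat split; try easy; (destruct (Req_dec (s_of p ^ 2) 1) as [K|]; [|nra]);
  destruct Hp as [_ Hp]; change (belt_form p > 0) in Hp; rewrite <- E, chart_belt_form in Hp by easy;
  unfold mu in Hp; rewrite K in Hp; unfold Rdiv in Hp; rewrite Rminus_diag, Rmult_0_r, !Rmult_0_l in Hp; lra.
Qed.

(* [e = 1] gives the right null line field and [e = -1] the left one. *)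
Definition sign_field (e : R) (l : line_field) : Prop :=
  null_line_field a b c l /\
  (forall t : R, spans_line (l (equator_pt a b t))
     (pt (- sqrt a * sin t) (sqrt b * cos t) (e * equator_f a b t))).

Lemma equator_pt_loc t : equator_pt a b t = loc 0 t.
Proof.
  unfold equator_pt, loc, chart, Xr, Yr. rewrite Rmult_0_r.
  do 2 f_equal; f_equal; f_equal; unfold mu; field; lra.
Qed.

Lemma equator_vec_push e t :
  pt (- sqrt a * sin t) (sqrt b * cos t) (e * equator_f a b t) =
  push 0 (cos t) (sin t) (e * equator_f a b t / Zr (cos t) (sin t)) 1.
Proof.
  pose proof (proj1 (Zr_spec _ _ (circle t))).
  unfold push. replace (Xr 0) with (sqrt a) by (unfold Xr; f_equal; unfold mu; field; lra).
  replace (Yr 0) with (sqrt b) by (unfold Yr; f_equal; unfold mu; field; lra).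
  unfold pt; f_equal; [f_equal|]; unfold Rdiv; try ring.
  rewrite !Rmult_0_r, !Rmult_0_l. field; lra.
Qed.

Lemma equator_f_pos t : 0 < equator_f a b t.
Proof. apply sqrt_lt_R0. exact (Rlt_le_trans _ _ _ hb (proj1 (nu_bounds _ _ (circle t)))). Qed.

Lemma scale_push s C S p q r :
  pt (r * xc (push s C S p q)) (r * yc (push s C S p q)) (r * zc (push s C S p q))
  = push s C S (r * p) (r * q).
Proof. unfold push, pt, xc, yc, zc; cbn [fst snd]. f_equal; [f_equal|]; ring. Qed.

Lemma push_0 s C S : push s C S 0 0 = pt 0 0 0.
Proof. unfold push, pt; f_equal; [f_equal|]; ring. Qed.

(** Both densities are positive in the open belt, so the null equation makes [p] and [q] vanish
    together, which a nonzero vector excludes. *)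
Lemma null_coords s t w : -1 < s < 1 -> tangent a b c (loc s t) w -> minkowski w w = 0 ->
  w <> pt 0 0 0 ->
  let p := coord_s s (cos t) (sin t) w in let q := coord_phi s (cos t) (sin t) w in
  w = push s (cos t) (sin t) p q /\ p <> 0 /\ q <> 0 /\
  (dens_phi (cos t) (sin t) * q) ^ 2 = (dens_s s * p) ^ 2.
Proof.
  intros Hs Ht Hm Hw p q. pose proof (circle t) as H.
  assert (E : push s (cos t) (sin t) p q = w) by (apply push_coords; [lra|easy|easy]).
  rewrite <- E, push_minkowski in Hm by (lra || easy).
  pose proof (mu_gt0 s Hs); pose proof (nu_bounds _ _ H).
  pose proof (dens_s_gt0 s Hs) as HA; pose proof (proj1 (dens_phi_spec _ _ H)) as HB.
  apply Rmult_integral in Hm; destruct Hm as [|Hm]; [lra|].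
  split; [easy|].
  assert (K : p = 0 /\ q = 0 -> False).
  { intros [Kp Kq]. apply Hw. rewrite <- E, Kp, Kq. apply push_0. }
  repeat split; [| |lra]; intros K0; apply K; split; try easy.
  - rewrite K0 in Hm. assert (K1 : (dens_phi (cos t) (sin t) * q) ^ 2 = 0) by lra.
    assert (dens_phi (cos t) (sin t) * q = 0) by nra. nra.
  - rewrite K0 in Hm. assert (K1 : (dens_s s * p) ^ 2 = 0) by lra.
    assert (dens_s s * p = 0) by nra. nra.
Qed.

Lemma continuous_loc_s s t : -1 < s < 1 -> continuous (fun u => loc u t) s.
Proof.
  intros Hs. eapply continuous_of_is_derive_R3.
  apply (is_derive_loc (fun u => u) (fun _ => t)); 
    [lra | apply (is_derive_id (K := R_AbsRing)) | apply is_derive_const].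
Qed.

Lemma spans_coords s t l V w : -1 < s < 1 -> spans_line l V -> l w -> w <> pt 0 0 0 ->
  tangent a b c (loc s t) V ->
  exists r, r <> 0 /\ coord_s s (cos t) (sin t) w = r * coord_s s (cos t) (sin t) V /\
  coord_phi s (cos t) (sin t) w = r * coord_phi s (cos t) (sin t) V.
Proof.
  intros Hs [HV Hl] Hw Hw0 HT. apply Hl in Hw. destruct Hw as [r Hr].
  pose proof (circle t) as H.
  rewrite <- (push_coords s (cos t) (sin t) V) in Hr by (lra || easy).
  rewrite scale_push in Hr. exists r; split; [|split].
  - intros K; apply Hw0. rewrite Hr, K, !Rmult_0_l. apply push_0.
  - rewrite Hr at 1. apply coord_s_push; [lra|easy].
  - rewrite Hr at 1. apply coord_phi_push; [lra|easy].
Qed.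

(** The product of the two coordinates of a nonzero null vector is nonzero and is multiplied by
    [r^2] under rescaling, so its sign belongs to the line. Continuity carries this sign from the
    equator along the meridian of angle [t]. *)
Lemma sign_field_coords e l s t w : e ^ 2 = 1 -> sign_field e l -> -1 < s < 1 ->
  l (loc s t) w -> w <> pt 0 0 0 ->
  0 < e * (coord_s s (cos t) (sin t) w * coord_phi s (cos t) (sin t) w).
Proof.
  intros He [[Hl Hn] Heq] Hs. revert w.
  set (D := fun u w => e * (coord_s u (cos t) (sin t) w * coord_phi u (cos t) (sin t) w)).
  set (P := fun u => forall w, l (loc u t) w -> w <> pt 0 0 0 -> 0 < D u w).
  change (P s). pose proof (circle t) as H.
  assert (P0 : P 0).
  { intros w Hw Hw0. specialize (Heq t). rewrite equator_pt_loc in Heq.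
    destruct (proj1 (proj2 Heq w) Hw) as [r Hr].
    rewrite equator_vec_push, scale_push in Hr.
    unfold D. rewrite Hr, coord_s_push, coord_phi_push by (lra || easy).
    pose proof (proj1 (Zr_spec _ _ H)). pose proof (equator_f_pos t).
    assert (r <> 0). { intros K; apply Hw0. rewrite Hr, K, !Rmult_0_l. apply push_0. }
    replace (e * (r * (e * equator_f a b t / Zr (cos t) (sin t)) * (r * 1)))
      with (e ^ 2 * (r ^ 2 * (equator_f a b t / Zr (cos t) (sin t)))) by (field; lra).
    rewrite He, Rmult_1_l. apply Rmult_lt_0_compat; [nra | now apply Rdiv_lt_0_compat]. }
  assert (HP : forall u, -1 < u < 1 -> exists d : posreal, forall v, -1 < v < 1 ->
    Rabs (v - u) < d -> (P u <-> P v)).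
  { intros u Hu.
    destruct (Hl (loc u t) (belt_loc u t Hu)) as (U & V & HU & HUu & HV & HlV).
    (* [P v] concerns every vector of the line; by homogeneity it reduces to the sign of [D] at the
       single vector provided by [V]. *)
    assert (HV0 : forall v, -1 < v < 1 -> U (loc v t) ->
      V (loc v t) <> pt 0 0 0 /\ tangent a b c (loc v t) (V (loc v t)) /\
      minkowski (V (loc v t)) (V (loc v t)) = 0 /\ (P v <-> 0 < D v (V (loc v t)))).
    { intros v Hv HUv. pose proof (HlV _ HUv (belt_loc v t Hv)) as HS.
      assert (Hin : l (loc v t) (V (loc v t))).
      { apply (proj2 HS). exists 1. destruct (V (loc v t)) as [[x y] z].
        unfold pt, xc, yc, zc; cbn [fst snd]. now rewrite !Rmult_1_l. }
      destruct (Hn _ _ (belt_loc v t Hv) Hin) as [HT HM].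
      split; [exact (proj1 HS)|]. split; [easy|]. split; [easy|]. split.
      - intros Hp. apply Hp; [easy | exact (proj1 HS)].
      - intros HD w Hw Hw0.
        destruct (spans_coords v t _ _ w Hv HS Hw Hw0 HT) as (r & Hr & E1 & E2).
        unfold D in *. rewrite E1, E2.
        match goal with |- 0 < ?x =>
          replace x with (r ^ 2 * (e * (coord_s v (cos t) (sin t) (V (loc v t)) * coord_phi v (cos t) (sin t) (V (loc v t))))) by ring end.
        apply Rmult_lt_0_compat; [nra | easy]. }
    assert (HUl : locally u (fun v => -1 < v < 1 /\ U (loc v t))).
    { apply filter_and.
      - apply (open_and _ _ (open_gt (-1)) (open_lt 1) u Hu).
      - apply (continuous_loc_s u t Hu U), HU, HUu. }
    (* [V] is continuous only relative to [U] and the belt; near [u] the meridian stays in both, so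
       the composite is continuous in the ordinary sense. *)
    assert (HVc : continuous (fun v => V (loc v t)) u).
    { intros Q HQ. specialize (HV (loc u t) (conj HUu (belt_loc u t Hu)) Q HQ).
      pose proof (continuous_loc_s u t Hu _ HV) as K. unfold filtermap in *.
      generalize (filter_and _ _ HUl K). apply filter_imp. intros v [[Hv HUv] Kv].
      apply Kv. split; [easy | now apply belt_loc]. }
    assert (Dc : continuous (fun v => D v (V (loc v t))) u).
    { assert (Cx : continuous (fun v => xc (V (loc v t))) u)
        by (apply (continuous_comp _ xc); [easy | apply continuous_xc]).
      assert (Cy : continuous (fun v => yc (V (loc v t))) u)
        by (apply (continuous_comp _ yc); [easy | apply continuous_yc]).
      assert (Cz : continuous (fun v => zc (V (loc v t))) u)
        by (apply (continuous_comp _ zc); [easy | apply continuous_zc]).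
      assert (Hu' : -1 <= u <= 1) by lra.
      assert (CX : continuous Xr u)
        by (apply (ex_derive_continuous (V := R_NormedModule)); eexists; now apply is_derive_Xr).
      assert (CY : continuous Yr u)
        by (apply (ex_derive_continuous (V := R_NormedModule)); eexists; now apply is_derive_Yr).
      pose proof (proj1 (Xr_spec u Hu')); pose proof (proj1 (Yr_spec u Hu')).
      pose proof (proj1 (Zr_spec _ _ H)).
      pose proof (mu_gt0 u Hu); pose proof (nu_bounds _ _ H).
      assert (0 < (a + c) * (b + c) * Zr (cos t) (sin t))
        by (apply Rmult_lt_0_compat; [apply Rmult_lt_0_compat; lra | easy]).
      assert (Cm : continuous mu u) by (unfold mu; cont).
      unfold D, coord_s, coord_phi; cont; lra. }
    destruct (HV0 u Hu HUu) as (N1 & N2 & N3 & N4).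
    destruct (null_coords u t _ Hu N2 N3 N1) as (_ & Np & Nq & _).
    assert (e <> 0) by nra.
    assert (ND : D u (V (loc u t)) <> 0) 
      by (apply Rmult_integral_contrapositive_currified;
          [easy | now apply Rmult_integral_contrapositive_currified]).
    (* Since [D] does not vanish at [u], either of its signs persists nearby. *)
    assert (Hsgn : locally u (fun v => 0 < D v (V (loc v t)) <-> 0 < D u (V (loc u t)))).
    { destruct (Rlt_dec 0 (D u (V (loc u t)))) as [K|K].
      - generalize (cont_pos_near _ _ Dc K). apply filter_imp. tauto.
      - assert (K' : 0 < - D u (V (loc u t))) by lra.
        generalize (cont_pos_near _ _ (cont_opp _ _ Dc) K'). apply filter_imp.
        intros v Hv; split; intros; lra. }
    destruct (filter_and _ _ HUl Hsgn) as [d Hd]. exists d. intros v Hv Hvd.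
    destruct (Hd v Hvd) as [[_ HUv] Hs'].
    destruct (HV0 v Hv HUv) as (_ & _ & _ & M4). tauto. }
  destruct (Rle_dec 0 s) as [K|K].
  - apply (locally_constant_prop P 0 s); [easy| |easy].
    intros u Hu. destruct (HP u) as [d Hd]; [lra|]. exists d. intros; apply Hd; [lra|easy].
  - apply (locally_constant_prop P s 0); [lra| |easy].
    intros u Hu. destruct (HP u) as [d Hd]; [lra|]. exists d. intros; apply Hd; [lra|easy].
Qed.

(** The null condition factors into two linear equations and the sign found above rules out the
    wrong one. The remaining equation says that [beta - e * alpha] has derivative zero in the
    direction [(p, q)]. *)
Lemma sign_field_direction e l s t p q : e ^ 2 = 1 -> sign_field e l -> -1 < s < 1 ->
  l (loc s t) (push s (cos t) (sin t) p q) -> push s (cos t) (sin t) p q <> pt 0 0 0 ->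
  e * (dens_s s * p) = dens_phi (cos t) (sin t) * q.
Proof.
  intros He Hl Hs Hw Hw0. pose proof (circle t) as H.
  pose proof (sign_field_coords e l s t _ He Hl Hs Hw Hw0) as HD.
  destruct (proj2 (proj1 Hl) _ _ (belt_loc s t Hs) Hw) as [HT HM].
  destruct (null_coords s t _ Hs HT HM Hw0) as (_ & _ & _ & E).
  rewrite coord_s_push, coord_phi_push in HD, E by (lra || easy).
  pose proof (dens_s_gt0 s Hs) as HA; pose proof (proj1 (dens_phi_spec _ _ H)) as HB.
  set (A := dens_s s) in *; set (B := dens_phi (cos t) (sin t)) in *.
  assert (K : (e * (A * p) - B * q) * (e * (A * p) + B * q) = 0).
  { transitivity (e ^ 2 * (A * p) ^ 2 - (B * q) ^ 2); [ring | rewrite He; lra]. }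
  apply Rmult_integral in K; destruct K as [K|K]; [lra|exfalso].
  assert (E1 : A * (e * (p * q)) = - B * q ^ 2) by (replace (A * (e * (p * q))) with (e * (A * p) * q) by ring;
    replace (e * (A * p)) with (- (B * q)) by lra; ring).
  pose proof (pow2_ge_0 q). assert (0 < A * (e * (p * q))) by (now apply Rmult_lt_0_compat). nra.
Qed.

(** * The first integral along a null geodesic *)

(* The first integral [beta phi - e * alpha s] is only defined modulo [beta (2 * PI)],
   because the angle is. *)
Definition on_level (e u : R) (p : R3) : Prop :=
  exists t, p = loc (s_of p) t /\ beta t - e * alpha (s_of p) = u.

Lemma s_of_loc s t : -1 <= s <= 1 -> s_of (loc s t) = s.
Proof. intros Hs; now apply of_chart; [|apply circle]. Qed.

Lemma loc_angle s t t' : -1 <= s <= 1 -> loc s t = loc s t' ->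
  exists k : Z, t' = t + IZR k * (2 * PI).
Proof.
  intros Hs E.
  destruct (of_chart s _ _ Hs (circle t)) as (_ & E1 & E2).
  destruct (of_chart s _ _ Hs (circle t')) as (_ & E3 & E4).
  fold (loc s t) in E1, E2. fold (loc s t') in E3, E4. rewrite E in E1, E2.
  apply angle_unique; congruence.
Qed.

Lemma tropic_closed p : tropic a b c p -> closed_belt p.
Proof.
  intros Hp. assert (K : ellipsoid a b c p /\ zc p ^ 2 = c ^ 2 * (xc p ^ 2 / a ^ 2 + yc p ^ 2 / b ^ 2)).
  { assert (0 <= xc p ^ 2 / a ^ 2 + yc p ^ 2 / b ^ 2).
    { apply Rplus_le_le_0_compat; apply Rdiv_le_0_compat; try apply pow2_ge_0; nra. }
    destruct Hp as [[H1 H2]|[H1 H2]]; split; try easy; rewrite H2.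
    - rewrite Rpow_mult_distr, pow2_sqrt by easy. reflexivity.
    - replace ((- (c * sqrt (xc p ^ 2 / a ^ 2 + yc p ^ 2 / b ^ 2))) ^ 2)
        with (c ^ 2 * sqrt (xc p ^ 2 / a ^ 2 + yc p ^ 2 / b ^ 2) ^ 2) by ring.
      rewrite pow2_sqrt by easy. reflexivity. }
  destruct K as [K1 K2]. split; [easy|]. unfold belt_form. rewrite K2.
  apply Req_le. field; lra.
Qed.

Lemma geodesic_closed l g s : null_geodesic a b c l g -> 0 <= s <= 1 -> closed_belt (g s).
Proof.
  intros (_ & H0 & H1 & H) Hs.
  destruct (Req_dec s 0) as [->|]; [now apply tropic_closed|].
  destruct (Req_dec s 1) as [->|]; [now apply tropic_closed|].
  apply belt_closed, H; lra.
Qed.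

(** A local lift [ph] of the angle makes [beta ph - e * alpha f] a genuine function, continuous up
    to the endpoints and with zero derivative in the open interval; hence it is constant near
    [s0]. *)
Lemma geodesic_level_local e l g : e ^ 2 = 1 -> sign_field e l -> null_geodesic a b c l g ->
  forall u s0, 0 <= s0 <= 1 -> exists d : posreal, forall s, 0 <= s <= 1 -> Rabs (s - s0) < d ->
    (on_level e u (g s0) <-> on_level e u (g s)).
Proof.
  intros He Hl Hg u s0 Hs0.
  (* Clamping the parameter extends the curve past 0 and 1, so that neighbourhoods of the endpoints
     need no separate treatment. *)
  set (G := fun s => g (clamp 0 1 s)).
  assert (H01 : 0 <= 1) by lra.
  assert (GB : forall s, closed_belt (G s)).
  { intros s; apply (geodesic_closed l g); [exact Hg | now apply clamp_in]. }
  assert (Gc : forall s, continuous G s) by (intros s; apply continuous_clamp; [exact H01 | apply Hg]).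
  set (f := fun s => s_of (G s)). set (C := fun s => C_of (G s)). set (S := fun s => S_of (G s)).
  assert (Hc : forall s, continuous f s /\ continuous C s /\ continuous S s).
  { intros s. destruct (continuous_of _ (GB s)) as (K1 & K2 & K3).
    repeat split; [apply (continuous_comp G s_of) | apply (continuous_comp G C_of)
      | apply (continuous_comp G S_of)]; easy. }
  assert (HG : forall s, -1 <= f s <= 1 /\ C s ^ 2 + S s ^ 2 = 1 /\ chart (f s) (C s) (S s) = G s).
  { intros s; apply chart_of, GB. }
  destruct (polar _ _ (proj1 (proj2 (HG s0)))) as (t0 & Hc0 & Hs0').
  (* The cosine of the angle swept since [s0]: it is 1 at [s0], and the branch of [local_angle] is
     valid as long as it is positive. *)
  set (D := fun s => C s * cos t0 + S s * sin t0).
  assert (Dc : forall s, continuous D s).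
  { intros s; destruct (Hc s) as (K1 & K2 & K3). unfold D; cont. }
  assert (D0 : 0 < D s0).
  { unfold D. rewrite Hc0, Hs0'. pose proof (proj1 (proj2 (HG s0))). nra. }
  destruct (cont_pos_near _ _ (Dc s0) D0) as [d Hd].
  set (q := fun s => (S s * cos t0 - C s * sin t0) / D s).
  set (ph := fun s => t0 + atan (q s)).
  assert (Hph : forall s, Rabs (s - s0) < d -> G s = loc (f s) (ph s) /\ continuous ph s).
  { intros s Hs. pose proof (Hd s Hs) as HD. destruct (HG s) as (K1 & K2 & K3). split.
    - destruct (local_angle t0 (C s) (S s) K2 HD) as [E1 E2]. unfold loc.
      change (cos (ph s) = C s) in E1. change (sin (ph s) = S s) in E2. now rewrite E1, E2, K3.
    - unfold ph. apply cont_plus; [apply continuous_const|].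
      apply (continuous_comp q atan); [|apply (ex_derive_continuous (V := R_NormedModule)); auto_derive; easy].
      destruct (Hc s) as (L1 & L2 & L3). unfold q. cont; [apply Dc | lra]. }
  set (H := fun s => beta (ph s) - e * alpha (f s)).
  assert (Hcont : forall s, Rabs (s - s0) < d -> continuous H s).
  { intros s Hs. unfold H. destruct (Hph s Hs) as [_ L].
    apply cont_minus; [apply (continuous_comp ph beta); [easy | apply continuous_beta]|].
    apply cont_mult; [apply continuous_const|].
    apply (continuous_comp f alpha); [apply Hc | apply continuous_alpha]. }
  assert (Hder : forall s, Rabs (s - s0) < d -> 0 < s < 1 -> is_derive H s 0).
  { intros s Hs Hs1.
    destruct (proj2 (proj2 (proj2 Hg)) s Hs1) as (HB & v & Hv & Hv0 & Hlv).
    assert (Gs : G s = g s) by (unfold G; rewrite clamp_id; [easy|lra]).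
    assert (HvG : is_derive G s v).
    { apply (is_derive_ext_loc g); [|easy].
      generalize (open_and _ _ (open_gt 0) (open_lt 1) s Hs1). apply filter_imp.
      intros x [Hx1 Hx2]. unfold G; rewrite clamp_id; [easy|lra]. }
    destruct (ex_derive_of G s (GB s) (ex_intro _ v HvG)) as (Df & DC & DS).
    fold f in Df; fold C in DC; fold S in DS. change (fun u => S_of (G u)) with S in DS.
    assert (Dph : ex_derive ph s).
    { pose proof (Hd s Hs) as HD. unfold D in HD. unfold ph, q, D. auto_derive.
      repeat split; try easy; lra. }
    destruct Df as [df Df], Dph as [dp Dp].
    destruct (belt_inv _ HB) as (_ & Hf & _). rewrite <- Gs in Hf. fold (f s) in Hf.
    assert (HL : is_derive G s (push (f s) (cos (ph s)) (sin (ph s)) df dp)).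
    { apply (is_derive_ext_loc (fun x => loc (f x) (ph x))).
      - pose proof (Rabs_def2 _ _ Hs) as [K1 K2].
        assert (K : s0 - d < s /\ s < s0 + d) by lra.
        generalize (open_and _ _ (open_gt (s0 - d)) (open_lt (s0 + d)) s K). apply filter_imp.
        intros x [Hx1 Hx2]. symmetry; apply Hph, Rabs_def1; lra.
      - apply is_derive_loc; [lra | easy | easy]. }
    (* Both vectors are derivatives of the same curve, so they agree by uniqueness in each
       component. *)
    assert (Ev : v = push (f s) (cos (ph s)) (sin (ph s)) df dp).
    { apply is_derive_R3 in HvG, HL. destruct HvG as (A1 & A2 & A3), HL as (B1 & B2 & B3).
      revert A1 A2 A3 B1 B2 B3. generalize (push (f s) (cos (ph s)) (sin (ph s)) df dp).
      clear. destruct v as [[x y] z]; intros [[x' y'] z']; unfold xc at 2, yc at 2, zc at 2; cbn [fst snd].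
      intros. repeat f_equal.
      - rewrite <- (is_derive_unique _ _ _ A1). apply (is_derive_unique _ _ _ B1).
      - rewrite <- (is_derive_unique _ _ _ A2). apply (is_derive_unique _ _ _ B2).
      - rewrite <- (is_derive_unique _ _ _ A3). apply (is_derive_unique _ _ _ B3). }
    rewrite Ev in Hv0, Hlv. rewrite <- Gs, (proj1 (Hph s Hs)) in Hlv.
    pose proof (sign_field_direction e l (f s) (ph s) df dp He Hl Hf Hlv Hv0) as Edir.
    pose proof (is_derive_alpha (f s)) as Ha; pose proof (is_derive_beta (ph s)) as Hb.
    unfold H. auto_derive.
    - repeat split; eexists; eassumption.
    - rewrite (is_derive_unique (fun x : R => ph x) _ _ Dp), (is_derive_unique (fun x : R => f x) _ _ Df).
      rewrite (is_derive_unique (fun x : R => beta x) _ _ Hb), (is_derive_unique (fun x : R => alpha x) _ _ Ha).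
      lra. }
  assert (Hconst : forall s s', Rabs (s - s0) < d -> Rabs (s' - s0) < d ->
    0 <= s -> s <= s' -> s' <= 1 -> H s = H s').
  { intros s s' Hs Hs' A1 A2 A3. apply constant_of_derive_0; [easy| |].
    - intros x Hx. apply Hcont. apply Rabs_def2 in Hs, Hs'. apply Rabs_def1; lra.
    - intros x Hx. apply Hder; [|lra]. apply Rabs_def2 in Hs, Hs'. apply Rabs_def1; lra. }
  assert (Hstep : forall s s', Rabs (s - s0) < d -> Rabs (s' - s0) < d -> 0 <= s <= 1 -> 0 <= s' <= 1 ->
    on_level e u (g s) -> on_level e u (g s')).
  { intros s s' Hs Hs' A A' (t & Et & Eu).
    assert (EH : H s = H s') by (destruct (Rle_dec s s'); [|symmetry]; apply Hconst; lra).
    assert (Gs : G s = g s) by (unfold G; rewrite clamp_id; [easy|lra]).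
    assert (Gs' : G s' = g s') by (unfold G; rewrite clamp_id; [easy|lra]).
    rewrite <- Gs in Et, Eu. fold (f s) in Et, Eu. unfold on_level. rewrite <- Gs'. fold (f s').
    destruct (Hph s Hs) as [E1 _], (Hph s' Hs') as [E2 _].
    rewrite E1 in Et. destruct (loc_angle _ _ _ (proj1 (HG s)) Et) as [k Hk].
    (* The angle witnessing the level at [s] may differ from the lift by [k] turns; the same [k]
       serves at [s']. *)
    exists (ph s' + IZR k * (2 * PI)). split; [now rewrite loc_period|].
    rewrite Hk in Eu. rewrite beta_periodZ in Eu |- *. unfold H in EH. lra. }
  exists d. intros s Hs Hsd. assert (Rabs (s0 - s0) < d).
  { rewrite Rminus_diag, Rabs_R0. apply cond_pos. }
  split; apply Hstep; easy.
Qed.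

Lemma geodesic_level e l g u s s' : e ^ 2 = 1 -> sign_field e l -> null_geodesic a b c l g ->
  0 <= s <= 1 -> 0 <= s' <= 1 -> on_level e u (g s) -> on_level e u (g s').
Proof.
  intros He Hl Hg Hs Hs'.
  assert (K : forall x y, 0 <= x -> x <= y -> y <= 1 -> (on_level e u (g x) <-> on_level e u (g y))).
  { intros x y H1 H2 H3. apply (locally_constant_prop (fun s => on_level e u (g s))); [easy|].
    intros r Hr. destruct (geodesic_level_local e l g He Hl Hg u r) as [d Hd]; [lra|].
    exists d. intros; apply Hd; [lra|easy]. }
  destruct (Rle_dec s s'); [apply (K s s') | apply (K s' s)]; lra.
Qed.

(** * Existence of null geodesics and the map [T] *)

(** The choice [(p, q) = (dens_phi, e * dens_s)] solves the null equation with sign [e] and, unlike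
    one normalized by [q = 1], extends to the tropics, where [dens_s] vanishes. *)
Definition null_vec (e : R) (p : R3) : R3 :=
  push (s_of p) (C_of p) (S_of p) (dens_phi (C_of p) (S_of p)) (e * dens_s (s_of p)).
Definition null_field (e : R) : line_field := fun p => in_span (null_vec e p).

Lemma null_vec_loc e s t : -1 <= s <= 1 ->
  null_vec e (loc s t) =
  push s (cos t) (sin t) (dens_phi (cos t) (sin t)) (e * dens_s s).
Proof.
  intros Hs. unfold null_vec. destruct (of_chart s _ _ Hs (circle t)) as (E1 & E2 & E3).
  unfold loc; now rewrite E1, E2, E3.
Qed.

Lemma null_vec_neq0 e p : e ^ 2 = 1 -> closed_belt p -> null_vec e p <> pt 0 0 0.
Proof.
  intros He Hp K. destruct (chart_of p Hp) as (Hs & H & _).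
  pose proof (push_null_z _ _ _ e Hs H He) as Hz. fold (null_vec e p) in Hz.
  rewrite K in Hz. unfold zc, pt in Hz; cbn [snd] in Hz. lra.
Qed.

Lemma continuous_null_vec e p : closed_belt p -> continuous (null_vec e) p.
Proof.
  intros Hp. destruct (chart_of p Hp) as (Hs & H & _).
  destruct (continuous_of p Hp) as (Cs & CC & CS).
  assert (CX : continuous (fun q => Xr (s_of q)) p).
  { apply (continuous_comp s_of Xr); [easy|].
    apply (ex_derive_continuous (V := R_NormedModule)); eexists; now apply is_derive_Xr. }
  assert (CY : continuous (fun q => Yr (s_of q)) p).
  { apply (continuous_comp s_of Yr); [easy|].
    apply (ex_derive_continuous (V := R_NormedModule)); eexists; now apply is_derive_Yr. }
  assert (HK : 0 < (a + c) * (b + c)) by (apply Rmult_lt_0_compat; lra).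
  assert (CZ : continuous (fun q => Zr (C_of q) (S_of q)) p) by (unfold Zr, nu; cont; lra).
  assert (CA : continuous (fun q => dens_s (s_of q)) p)
    by (apply (continuous_comp s_of dens_s); [easy | apply continuous_dens_s]).
  pose proof (continuous_dens_phi _ _ p CC CS H) as CB.
  pose proof (proj1 (Xr_spec _ Hs)); pose proof (proj1 (Yr_spec _ Hs)).
  pose proof (proj1 (Zr_spec _ _ H)).
  unfold null_vec, push. apply continuous_pt; cont.
  - apply Rgt_not_eq, Rmult_lt_0_compat; lra.
  - apply Rgt_not_eq, Rmult_lt_0_compat; lra.
  - apply Rgt_not_eq, Rmult_lt_0_compat; lra.
Qed.

Lemma in_span_null s C S p q w : -1 <= s <= 1 -> C ^ 2 + S ^ 2 = 1 ->
  (dens_phi C S * q) ^ 2 = (dens_s s * p) ^ 2 ->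
  in_span (push s C S p q) w -> tangent a b c (chart s C S) w /\ minkowski w w = 0.
Proof.
  intros Hs H E [r ->]. rewrite scale_push. split; [now apply push_tangent|].
  rewrite push_minkowski by easy.
  replace (dens_phi C S * (r * q)) with (r * (dens_phi C S * q)) by ring.
  replace (dens_s s * (r * p)) with (r * (dens_s s * p)) by ring.
  rewrite (Rpow_mult_distr r (dens_phi C S * q)), (Rpow_mult_distr r (dens_s s * p)), E. ring.
Qed.

(** Comparing squares gives [dens_phi * Zr = dens_s 0 * equator_f] on the equator, so [null_vec] is
    the prescribed equator vector scaled by [e * dens_s 0]. *)
Lemma null_vec_equator e t : e ^ 2 = 1 ->
  null_vec e (loc 0 t) = push 0 (cos t) (sin t)
    ((e * dens_s 0) * (e * equator_f a b t / Zr (cos t) (sin t))) ((e * dens_s 0) * 1).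
Proof.
  intros He. rewrite null_vec_loc by lra. pose proof (circle t) as H.
  destruct (Zr_spec _ _ H) as [HZ0 HZ], (dens_phi_spec _ _ H) as [HB0 HB].
  pose proof (dens_s_gt0 0 ltac:(lra)) as HA0. pose proof (dens_s_sq 0 ltac:(lra)) as HA.
  pose proof (equator_f_pos t) as Hf. pose proof (nu_bounds _ _ H) as Hn.
  assert (Ef : equator_f a b t ^ 2 = nu (cos t) (sin t)) 
    by (unfold equator_f, nu in *; apply pow2_sqrt; lra).
  f_equal; [|ring].
  assert (E : dens_phi (cos t) (sin t) * Zr (cos t) (sin t) = dens_s 0 * equator_f a b t).
  { apply Rsqr_inj; [apply Rlt_le; now apply Rmult_lt_0_compat.. |].
    rewrite !Rsqr_pow2. rewrite !Rpow_mult_distr, HB, HZ, HA, Ef. unfold mu. field; lra. }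
  apply (Rmult_eq_reg_r (Zr (cos t) (sin t))); [|lra]. rewrite E.
  transitivity (e ^ 2 * (dens_s 0 * equator_f a b t)); [rewrite He; ring | field; lra].
Qed.

(** Provides actual right and left null line fields, as the existential quantifiers over fields in
    the definitions of null geodesics demand. A single global vector field witnesses continuity. *)
Lemma null_field_sign e : e ^ 2 = 1 -> sign_field e (null_field e).
Proof.
  intros He. split; [split|].
  - intros p Hp. exists (fun _ => True), (null_vec e).
    split; [apply open_true|]. split; [easy|]. split.
    + apply continuous_on_of_continuous. intros q [_ Hq]. now apply continuous_null_vec, belt_closed.
    + intros q _ Hq. split; [now apply null_vec_neq0, belt_closed | easy].
  - intros p w Hp Hw. destruct (belt_inv p Hp) as (t & Hs & _ & _ & Ep).
    rewrite Ep in Hw |- *. unfold null_field in Hw. rewrite null_vec_loc in Hw by lra.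
    apply (in_span_null _ _ _ _ _ w) in Hw; [easy | lra | apply circle |].
    transitivity (e ^ 2 * (dens_s (s_of p) * dens_phi (cos t) (sin t)) ^ 2); [ring | rewrite He; ring].
  - intros t. rewrite equator_pt_loc. unfold null_field. split.
    + intros K. apply (f_equal zc) in K. unfold zc, pt in K; cbn [snd] in K.
      pose proof (equator_f_pos t). nra.
    + intros w. rewrite null_vec_equator, <- scale_push, <- equator_vec_push by easy.
      set (v := pt _ _ (e * _)).
      assert (Hr : e * dens_s 0 <> 0).
      { pose proof (dens_s_gt0 0 ltac:(lra)). apply Rmult_integral_contrapositive_currified; nra. }
      set (r := e * dens_s 0) in *.
      unfold in_span, xc, yc, zc, pt; cbn [fst snd]. split; intros [x ->].
      * exists (x * r). now rewrite !Rmult_assoc.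
      * exists (x / r). unfold v, pt; cbn [fst snd].
        f_equal; [f_equal|]; field; easy.
Qed.

Lemma equator_loc t : equator a b c (loc 0 t).
Proof.
  split; [apply chart_ellipsoid; [lra | apply circle]|].
  unfold loc, chart, zc, pt; cbn [snd]; ring.
Qed.

Lemma equator_inv p : equator a b c p -> exists t, p = loc 0 t.
Proof.
  intros [Hp Hz].
  assert (HB : closed_belt p).
  { split; [easy|]. unfold belt_form. rewrite Hz.
    assert (0 <= xc p ^ 2 / a ^ 2 + yc p ^ 2 / b ^ 2).
    { apply Rplus_le_le_0_compat; apply Rdiv_le_0_compat; try apply pow2_ge_0; nra. }
    unfold Rdiv at 3. rewrite pow_i by lia. lra. }
  destruct (chart_of p HB) as (Hs & H & E). destruct (polar _ _ H) as (t & Hc & Ht).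
  exists t. unfold loc. rewrite Hc, Ht.
  replace 0 with (s_of p); [easy|].
  unfold s_of. rewrite Hz. unfold Rdiv; ring.
Qed.

Lemma belt_form_tropic t d : d ^ 2 = 1 ->
  sqrt (xc (loc d t) ^ 2 / a ^ 2 + yc (loc d t) ^ 2 / b ^ 2) = Zr (cos t) (sin t) / c.
Proof.
  intros Hd. assert (Hs : -1 <= d <= 1) by nra.
  pose proof (proj1 (Zr_spec _ _ (circle t))) as HZ.
  pose proof (chart_belt_form d _ _ Hs (circle t)) as E. unfold mu in E. rewrite Hd in E.
  fold (loc d t) in E. unfold belt_form in E.
  assert (Ez : zc (loc d t) ^ 2 / c ^ 2 = (Zr (cos t) (sin t) / c) ^ 2).
  { unfold loc, chart, zc, pt; cbn [snd]. rewrite Rpow_mult_distr, Hd. field; lra. }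
  rewrite <- (sqrt_pow2 (Zr (cos t) (sin t) / c)) by (apply Rlt_le, Rdiv_lt_0_compat; easy).
  f_equal. rewrite <- Ez.
  assert (c * (1 - 1) * nu (cos t) (sin t) / (a * b * c) = 0) by (field; lra). lra.
Qed.

Lemma loc_north t : north_tropic a b c (loc 1 t).
Proof.
  split; [apply chart_ellipsoid; [lra | apply circle]|].
  rewrite belt_form_tropic by ring. unfold loc, chart, zc, pt; cbn [snd]. field; lra.
Qed.

Lemma loc_south t : south_tropic a b c (loc (-1) t).
Proof.
  split; [apply chart_ellipsoid; [lra | apply circle]|].
  rewrite belt_form_tropic by ring. unfold loc, chart, zc, pt; cbn [snd]. field; lra.
Qed.

(** On a tropic [mu * nu] vanishes, so [s^2 = 1]; the nonnegative height selects the sign. *)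
Lemma s_of_north p : north_tropic a b c p -> s_of p = 1.
Proof.
  intros Hp. pose proof (tropic_closed p (or_introl Hp)) as HB.
  destruct (chart_of p HB) as (Hs & H & E). destruct Hp as [_ Hz].
  pose proof (chart_belt_form _ _ _ Hs H) as K. rewrite E in K.
  assert (Hz0 : 0 <= zc p) by (rewrite Hz; apply Rmult_le_pos; [lra | apply sqrt_pos]).
  assert (F : belt_form p = 0).
  { unfold belt_form. rewrite Hz, Rpow_mult_distr, pow2_sqrt; [field; lra|].
    apply Rplus_le_le_0_compat; apply Rdiv_le_0_compat; try apply pow2_ge_0; nra. }
  rewrite F in K. pose proof (nu_bounds _ _ H) as Hn.
  assert (Hm : mu (s_of p) * nu (C_of p) (S_of p) = 0).
  { transitivity (mu (s_of p) * nu (C_of p) (S_of p) / (a * b * c) * (a * b * c));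
      [field; lra | rewrite <- K; ring]. }
  apply Rmult_integral in Hm; destruct Hm as [Hm|]; [|lra].
  assert (0 <= s_of p).
  { unfold s_of. apply Rdiv_le_0_compat; [easy|].
    apply Rmult_lt_0_compat; [easy|]. apply sqrt_lt_R0, conf_pos, HB. }
  unfold mu in Hm. apply Rmult_integral in Hm; destruct Hm as [|Hm]; [lra|]. nra.
Qed.

Lemma geodesic_exists e d u : e ^ 2 = 1 -> d ^ 2 = 1 -> exists g,
  null_geodesic a b c (null_field e) g /\
  (forall s, exists t, g s = loc (d * (2 * s - 1)) t /\ beta t = u + e * alpha (d * (2 * s - 1))) /\
  (0 < d -> forall s s', 0 <= s -> s < s' -> s' <= 1 -> zc (g s) < zc (g s')).
Proof.
  intros He Hd. destruct beta_inverse as (h & Hbh & _ & Hh).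
  set (f := fun s => d * (2 * s - 1)).
  set (ph := fun s => h (u + e * alpha (f s))).
  exists (fun s => loc (f s) (ph s)).
  assert (Hf : forall s, 0 <= s <= 1 -> -1 <= f s <= 1).
  { intros s Hs. unfold f. assert ((d * (2 * s - 1)) ^ 2 <= 1) by (rewrite Rpow_mult_distr, Hd; nra).
    nra. }
  (* The ratio of the velocity to [null_vec]: the [s] component of the velocity is [2 * d], that of
     [null_vec] is [dens_phi]. *)
  set (r := fun s => 2 * d / dens_phi (cos (ph s)) (sin (ph s))).
  assert (Hder : forall s, 0 <= s <= 1 -> is_derive (fun s => loc (f s) (ph s)) s
    (push (f s) (cos (ph s)) (sin (ph s)) (r s * dens_phi (cos (ph s)) (sin (ph s))) (r s * (e * dens_s (f s))))).
  { intros s Hs. pose proof (proj1 (dens_phi_spec _ _ (circle (ph s)))) as HB.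
    apply is_derive_loc; [now apply Hf| |].
    - unfold r. replace (2 * d / dens_phi (cos (ph s)) (sin (ph s)) * dens_phi (cos (ph s)) (sin (ph s)))
        with (2 * d) by (field; lra).
      unfold f. auto_derive; [easy | ring].
    - pose proof (Hh (u + e * alpha (f s))) as H1. fold (ph s) in H1.
      pose proof (is_derive_alpha (f s)) as H2.
      assert (H3 : is_derive f s (2 * d)) by (unfold f; auto_derive; [easy | ring]).
      unfold ph. auto_derive.
      + repeat split; eexists; eassumption.
      + rewrite (is_derive_unique (fun x : R => h x) _ _ H1), (is_derive_unique (fun x : R => alpha x) _ _ H2),
          (is_derive_unique (fun x : R => f x) _ _ H3).
        unfold r. fold (ph s). field; lra. }
  assert (Hcont : forall s, 0 <= s <= 1 -> continuous (fun s => loc (f s) (ph s)) s).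
  { intros s Hs. eapply continuous_of_is_derive_R3. now apply Hder. }
  assert (Htr : forall x t, x ^ 2 = 1 -> tropic a b c (loc x t)).
  { intros x t Hx. assert (K : x = 1 \/ x = -1).
    { assert (K : (x - 1) * (x + 1) = 0) by lra. apply Rmult_integral in K. lra. }
    destruct K as [-> | ->]; [left; apply loc_north | right; apply loc_south]. }
  split; [split; [|split; [|split]]|split].
  - now apply continuous_on_of_continuous.
  - apply Htr. unfold f. rewrite Rpow_mult_distr, Hd. ring.
  - apply Htr. unfold f. rewrite Rpow_mult_distr, Hd. ring.
  - intros s Hs.
    assert (Hfs : -1 < f s < 1).
    { unfold f. assert ((d * (2 * s - 1)) ^ 2 < 1) by (rewrite Rpow_mult_distr, Hd; nra). nra. }
    split; [now apply belt_loc|].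
    pose proof (proj1 (dens_phi_spec _ _ (circle (ph s)))) as HB.
    pose proof (push_null_z (f s) _ _ e ltac:(lra) (circle (ph s)) He) as Hz.
    eexists; split; [apply Hder; lra|]. rewrite <- scale_push. split.
    + intros K. apply (f_equal zc) in K. unfold zc at 1 3, pt in K; cbn [snd] in K.
      apply Rmult_integral in K. destruct K as [K|K]; [|lra].
      assert (r s * dens_phi (cos (ph s)) (sin (ph s)) = 2 * d) by (unfold r; field; lra).
      rewrite K in *. nra.
    + unfold null_field. rewrite null_vec_loc by lra. now exists (r s).
  - intros s. exists (ph s). split; [easy|]. apply Hbh.
  - intros Hd0 s s' Hs Hss Hs'.
    apply (increasing_of_derive_pos (fun x => zc (loc (f x) (ph x)))
      (fun x => zc (push (f x) (cos (ph x)) (sin (ph x)) (r x * dens_phi (cos (ph x)) (sin (ph x)))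
         (r x * (e * dens_s (f x)))))); [easy| |].
    + intros x Hx. apply (continuous_comp (fun x => loc (f x) (ph x)) zc);
        [apply Hcont; lra | apply continuous_zc].
    + intros x Hx. assert (Hx' : 0 <= x <= 1) by lra. pose proof (Hder x Hx') as K.
      apply is_derive_R3 in K. split; [apply K|].
      rewrite <- scale_push. unfold zc at 1, pt; cbn [snd].
      apply Rmult_lt_0_compat; [|now apply push_null_z; [apply Hf|apply circle|]].
      pose proof (proj1 (dens_phi_spec _ _ (circle (ph x)))). unfold r. apply Rdiv_lt_0_compat; lra.
Qed.

(** * The map [T] as a translation in [beta] *)

Lemma right_sign_field l : right_null_field a b c l <-> sign_field 1 l.
Proof.
  unfold right_null_field, sign_field.
  split; intros [H1 H2]; (split; [easy|]); intros t; specialize (H2 t);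
  rewrite Rmult_1_l in *; easy.
Qed.

Lemma left_sign_field l : left_null_field a b c l <-> sign_field (-1) l.
Proof.
  unfold left_null_field, sign_field.
  assert (E : forall x, -1 * x = - x) by (intros; ring).
  split; intros [H1 H2]; (split; [easy|]); intros t; specialize (H2 t);
  rewrite E in *; easy.
Qed.

Lemma alpha_0 : alpha 0 = 0.
Proof. apply (RInt_point (V := R_CompleteNormedModule)). Qed.

Lemma T_graph_unique t t' P : beta t' = beta t + 2 * alpha 1 ->
  T_graph a b c (loc 0 t) P -> P = loc 0 t'.
Proof.
  intros Ht (Q & (g & s & (l & Hl & Hg) & _ & Hs & Egs & Eg1 & HQ)
     & (g' & s' & (l' & Hl' & Hg') & Eg0 & Hs' & Egs' & HP & _)).
  apply right_sign_field in Hl. apply left_sign_field in Hl'.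
  assert (L1 : on_level 1 (beta t) (g s)).
  { exists t. rewrite Egs, s_of_loc by lra. split; [easy|]. rewrite alpha_0; ring. }
  apply (geodesic_level 1 l g _ s 1) in L1; [|lra|easy|easy|lra|lra].
  rewrite Eg1 in L1. destruct L1 as (tq & EQ & Eq). rewrite (s_of_north Q HQ) in EQ, Eq.
  (* At [Q] the right level gives [beta tq = beta t + alpha 1], so the level of the left geodesic is
     [beta t + 2 * alpha 1], attained on the equator where [alpha] is 0. *)
  assert (L2 : on_level (-1) (beta tq + alpha 1) (g' 0)).
  { exists tq. rewrite Eg0, (s_of_north Q HQ). split; [easy|ring]. }
  apply (geodesic_level (-1) l' g' _ 0 s') in L2; [|lra|easy|easy|lra|lra].
  rewrite Egs' in L2. destruct L2 as (t1 & EP & Et1).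
  destruct (equator_inv P HP) as [t2 Et2].
  assert (E0 : s_of P = 0) by (rewrite Et2; apply s_of_loc; lra).
  rewrite E0 in EP, Et1. rewrite alpha_0 in Et1. rewrite EP.
  f_equal. apply beta_inj. lra.
Qed.

Lemma T_graph_exists t t' : beta t' = beta t + 2 * alpha 1 ->
  T_graph a b c (loc 0 t) (loc 0 t').
Proof.
  intros Ht. destruct beta_inverse as (h & Hbh & _ & _).
  set (tq := h (beta t + alpha 1)).
  assert (Eq : beta tq = beta t + alpha 1) by apply Hbh.
  exists (loc 1 tq). split.
  - destruct (geodesic_exists 1 1 (beta t)) as (g & Hg & Hgt & Hz); [lra|lra|].
    exists g, (/ 2). split; [|split; [apply Hz; lra|split; [lra|split; [|split]]]].
    + exists (null_field 1). split; [apply right_sign_field, null_field_sign; lra | easy].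
    + destruct (Hgt (/ 2)) as (x & -> & Ex). replace (1 * (2 * / 2 - 1)) with 0 in * by lra.
      f_equal. apply beta_inj. rewrite alpha_0 in Ex. lra.
    + destruct (Hgt 1) as (x & -> & Ex). replace (1 * (2 * 1 - 1)) with 1 in * by lra.
      f_equal. apply beta_inj. lra.
    + apply loc_north.
  (* The level [beta t'] makes the curve start at angle [tq], since [beta t' - alpha 1 = beta tq];
     the equator is met at parameter [/ 2], where [s = 0]. *)
  - destruct (geodesic_exists (-1) (-1) (beta t')) as (g & Hg & Hgt & _); [lra|lra|].
    exists g, (/ 2). split; [|split; [|split; [lra|split; [|split]]]].
    + exists (null_field (-1)). split; [apply left_sign_field, null_field_sign; lra | easy].
    + destruct (Hgt 0) as (x & -> & Ex). replace (-1 * (2 * 0 - 1)) with 1 in * by lra.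
      f_equal. apply beta_inj. lra.
    + destruct (Hgt (/ 2)) as (x & -> & Ex). replace (-1 * (2 * / 2 - 1)) with 0 in * by lra.
      f_equal. apply beta_inj. rewrite alpha_0 in Ex. lra.
    + apply equator_loc.
    (* Before [/ 2] the coordinate [s = 1 - 2 * v] is positive, hence so is the height. *)
    + intros v Hv [_ K]. destruct (Hgt v) as (x & Ex & _). rewrite Ex in K.
      unfold loc, chart, zc, pt in K; cbn [snd] in K.
      pose proof (proj1 (Zr_spec _ _ (circle x))). nra.
Qed.

(** Existence ensures that the value picked by [epsilon] lies on the graph, and uniqueness
    identifies it. *)
Lemma T_loc t t' : beta t' = beta t + 2 * alpha 1 -> T a b c (loc 0 t) = loc 0 t'.
Proof.
  intros Ht. apply (T_graph_unique t); [easy|]. unfold T. apply epsilon_spec.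
  exists (loc 0 t'). now apply T_graph_exists.
Qed.

Lemma T_iter_loc k t t' : beta t' = beta t + INR k * (2 * alpha 1) ->
  Nat.iter k (T a b c) (loc 0 t) = loc 0 t'.
Proof.
  revert t'; induction k as [|k IH]; intros t' Ht.
  - simpl in *. f_equal. apply beta_inj. lra.
  - destruct beta_inverse as (h & Hbh & _ & _). rewrite S_INR in Ht.
    change (Nat.iter (S k) (T a b c) (loc 0 t)) with (T a b c (Nat.iter k (T a b c) (loc 0 t))).
    rewrite (IH (h (beta t + INR k * (2 * alpha 1)))) by apply Hbh.
    apply T_loc. rewrite Hbh, Ht. ring.
Qed.

Lemma T_periodic k P P' : equator a b c P -> equator a b c P' ->
  Nat.iter k (T a b c) P = P -> Nat.iter k (T a b c) P' = P'.
Proof.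
  intros HP HP' Hk. destruct (equator_inv P HP) as [t ->], (equator_inv P' HP') as [t' ->].
  destruct beta_inverse as (h & Hbh & _ & _).
  rewrite (T_iter_loc k t (h (beta t + INR k * (2 * alpha 1)))) in Hk by apply Hbh.
  symmetry in Hk. destruct (loc_angle 0 _ _ ltac:(lra) Hk) as [m Hm].
  (* This yields [INR k * (2 * alpha 1) = IZR m * beta (2 * PI)], a relation without [t]; the same
     [m] therefore serves for [t']. *)
  apply (f_equal beta) in Hm. rewrite Hbh, beta_periodZ in Hm.
  rewrite (T_iter_loc k t' (t' + IZR m * (2 * PI))); [apply loc_period|].
  rewrite beta_periodZ. lra.
Qed.

End Belt.

Theorem theorem5p1 (a b c : R) (ha : 0 < a) (hb : 0 < b) (hc : 0 < c) (hab : b < a)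
    (k : nat) (hk : (0 < k)%nat)
    (P : R3) (hP : equator a b c P) (hper : Nat.iter k (T a b c) P = P) :
  forall P' : R3, equator a b c P' -> Nat.iter k (T a b c) P' = P'.
Proof.
  intros P' hP'. exact (T_periodic a b c ha hb hc hab k P P' hP hP' hper).
Qed.
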